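(* Let $G$ be a finite graph with $n$ edges, and let $C(G)$ be the Tutte chain complex of $G$ (defined in the context) with respect to a chosen ordering $e_1,\dots,e_n$ of $E(G)$. Then: (a) $0\to C^0(G)\xrightarrow{d^0}C^1(G)\xrightarrow{d^1}\cdots\xrightarrow{d^{n-1}}C^n(G)\to 0$ is a chain complex of bigraded $\mathbb{Z}$-modules (i.e. $d^{i+1}\circ d^i=0$) whose differential is degree preserving. (b) The cohomology groups $H^i(G)$ are independent of the ordering of the edges of $G$, and therefore are invariants of $G$; in fact the isomorphism class of the chain complex $C(G)$ is an invariant of $G$. (c) $\sum_{0\le i\le n}(-1)^i\, q\dim H^i(G)=\sum_{0\le i\le n}(-1)^i\, q\dim C^i(G)=\widehat{T}(G;x,y)$.
   Context: Graphs are finite, loops and multiple edges allowed. A bigraded $\mathbb{Z}$-module is $M=\bigoplus_{(i,j)\in\mathbb{Z}^2}M_{i,j}$; its graded dimension is $q\dim M=\sum_{i,j}x^iy^j\dim_{\mathbb{Q}}(M_{i,j}\otimes\mathbb{Q})$. Let $A=\mathbb{Z}[x]/(x^2)$ and $B=\mathbb{Z}[y]/(y^2)$ with $\deg 1=(0,0)$, $\deg x=(1,0)$, $\deg y=(0,1)$ (tensor products carry the induced bigrading); only the module structure of $B$ is used. For $s\subseteq E(G)$, $[G:s]$ is the spanning subgraph with vertex set $V(G)$ and edge set $s$, with $b_0(s)$ components and first Betti number $b_1(s)$. Set $C^s(G)=A^{\otimes b_0(s)}\otimes B^{\otimes b_1(s)}$, where the $A$ factors are indexed by the components of $[G:s]$,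 and $C^i(G)=\bigoplus_{|s|=i}C^s(G)$. For $s$ and $e_j\notin s$, the per-edge map $d_{s,j}:C^s(G)\to C^{s\cup\{e_j\}}(G)$ is: if $e_j$ joins two different components $E_1,E_2$ of $[G:s]$, it multiplies the $A$ factors of $E_1$ and $E_2$ ($a_1\otimes a_2\mapsto a_1a_2$, assigned to the merged component) and is the identity on all other factors (note $b_1$ is unchanged); if $e_j$ joins a component of $[G:s]$ to itself, it is the identity on $A^{\otimes b_0(s)}$ and sends $b\in B^{\otimes b_1(s)}$ to $b\otimes 1\in B^{\otimes b_1(s)+1}$. The differential is $d^i=\sum_{|s|=i}\sum_{e_j\notin s}(-1)^{|\{k<j:\,e_k\in s\}|}d_{s,j}$. $H^i(G)$ is the $i$-th cohomology of this complex. $\widehat{T}(G;x,y)=\sum_{s\subseteq E(G)}(-1)^{|s|}(1+x)^{b_0(s)}(1+y)^{b_1(s)}$. *)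

(* Defs.v *)
From HB Require Import structures.
From mathcomp Require Import all_boot all_order all_algebra.
From mathcomp Require Import boolp classical_sets functions cardinality fsbigop.

Set Implicit Arguments.
Unset Strict Implicit.
Unset Printing Implicit Defensive.

Import GRing.Theory.
Local Open Scope ring_scope.

(** * Finite graphs *)

(* An edge with one end is a loop; distinct edges may have the same ends. *)
Record mgraph := MGraph {
  vertex : finType;
  edge : finType;
  ends : edge -> {set vertex};
  card_ends : forall e : edge, (0 < #|ends e| <= 2)%N }.

Definition graph_iso (G G' : mgraph) : Prop :=
  exists (fV : vertex G -> vertex G') (fE : edge G -> edge G'),
    [/\ bijective fV, bijective fE
      & forall e : edge G, ends (fE e) = [set fV v | v in ends e]].

Section SpanningSubgraphs.
Variable G : mgraph.
Implicit Type s : {set edge G}.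

Definition adj s : rel (vertex G) :=
  fun u v => [exists e in s, ends e == [set u; v]].

Definition components s : {set {set vertex G}} :=
  equivalence_partition (connect (adj s)) [set: vertex G].

Definition b0 s : nat := #|components s|.

(* The truncated subtraction is exact: #|vertex G| <= #|s| + b0 s. *)
Definition b1 s : nat := (#|s| + b0 s - #|vertex G|)%N.

Definition That (R : comNzRingType) (x y : R) : R :=
  \sum_(s : {set edge G}) (-1) ^+ #|s| * (1 + x) ^+ b0 s * (1 + y) ^+ b1 s.

End SpanningSubgraphs.

(** * Subgroups, direct sums, bigraded modules and complexes *)

Record zsub (M : zmodType) (S : zmodClosed M) :=
  ZSub { zval : M; zvalP : zval \in S }.

Section ZSub.
Variables (M : zmodType) (S : zmodClosed M).
HB.instance Definition _ := [isSub for @zval M S].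
HB.instance Definition _ := [Choice of zsub S by <:].
HB.instance Definition _ := [SubChoice_isSubZmodule of zsub S by <:].
End ZSub.

Definition dsum (I : finType) (M : I -> zmodType) :=
  {dffun forall i : I, M i}.

Section DSum.
Variables (I : finType) (M : I -> zmodType).
Implicit Types u v w : dsum M.

HB.instance Definition _ := Choice.on (dsum M).

Definition dsum0 : dsum M := finfun (fun i => 0 : M i).
Definition dsum_opp u : dsum M := finfun (fun i => - u i).
Definition dsum_add u v : dsum M := finfun (fun i => u i + v i).

Fact dsum_addA : associative dsum_add.
Proof. by move=> u v w; apply/ffunP=> i; rewrite !ffunE addrA. Qed.
Fact dsum_addC : commutative dsum_add.
Proof. by move=> u v; apply/ffunP=> i; rewrite !ffunE addrC. Qed.
Fact dsum_add0 : left_id dsum0 dsum_add.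
Proof. by move=> u; apply/ffunP=> i; rewrite !ffunE add0r. Qed.
Fact dsum_addN : left_inverse dsum0 dsum_opp dsum_add.
Proof. by move=> u; apply/ffunP=> i; rewrite !ffunE addNr. Qed.

HB.instance Definition _ :=
  GRing.isZmodule.Build (dsum M) dsum_addA dsum_addC dsum_add0 dsum_addN.
End DSum.

(* The data of a bigraded module: a Z-module with a family of submodules
   indexed by Z^2; [bigraded] says that it is their direct sum. *)
Record bgmod := BGMod {
  bgsort :> zmodType;
  bgcomp : int * int -> zmodClosed bgsort }.

Definition bigraded (M : bgmod) : Prop :=
  forall u : M, exists! c : int * int -> M,
    [/\ finite_set [set p | c p != 0]%classic,
        forall p, c p \in bgcomp M p
      & u = \sum_(p \in [set: int * int]%classic) c p].

Definition bgiso (M N : bgmod) (f : {additive M -> N}) : Prop :=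
  bijective f /\ forall p u, (f u \in bgcomp N p) = (u \in bgcomp M p).

Definition bgisomorphic (M N : bgmod) : Prop :=
  exists f : {additive M -> N}, bgiso f.

(* The data of a cochain complex, indexed by nat; d o d = 0 and the
   compatibility of d with the bigradings are not part of the record. *)
Record cochain := Cochain {
  cterm :> nat -> bgmod;
  cdiff : forall i : nat, {additive cterm i -> cterm i.+1} }.

Definition cochain_isomorphic (K L : cochain) : Prop :=
  exists f : forall i : nat, {additive K i -> L i},
    (forall i, bgiso (f i)) /\
    (forall i (u : K i), f i.+1 (cdiff K i u) = cdiff L i (f i u)).

Section Cohomology.
Variables (K : cochain) (i : nat).

Definition cycle_pred : {pred K i} := fun u => cdiff K i u == 0.

Fact cycle_closed : zmod_closed cycle_pred.
Proof.
split=> [|u v]; first by rewrite unfold_in raddf0.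
by rewrite !unfold_in raddfB => /eqP-> /eqP->; rewrite subrr.
Qed.
HB.instance Definition _ :=
  GRing.isZmodClosed.Build (K i) cycle_pred cycle_closed.

Definition cycles := zsub cycle_pred.

Definition is_coboundary (j : nat) : K j -> Prop :=
  match j with
  | 0 => fun u => u = 0
  | k.+1 => fun u => exists v : K k, u = cdiff K k v
  end.

Definition boundary_pred : {pred cycles} :=
  fun z => `[< is_coboundary (val z) >].

Fact boundary_closed : zmod_closed boundary_pred.
Proof.
have cl0 j : @is_coboundary j 0.
  by case: j => [|j] //=; exists 0; rewrite raddf0.
have clB j (u v : K j) :
    is_coboundary u -> is_coboundary v -> is_coboundary (u - v).
  case: j u v => [|j] u v /=; first by move=> -> ->; rewrite subrr.
  by move=> [u' ->] [v' ->]; exists (u' - v'); rewrite raddfB.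
split=> [|z t]; first by rewrite unfold_in raddf0; apply/asboolP.
rewrite !unfold_in raddfB => /asboolP hz /asboolP ht.
by apply/asboolP/clB.
Qed.
HB.instance Definition _ :=
  GRing.isZmodClosed.Build cycles boundary_pred boundary_closed.

Definition cohomology_group : zmodType := Quotient.quot boundary_pred.

Definition cohomology_comp_pred (p : int * int) : {pred cohomology_group} :=
  fun h => `[< exists2 z : cycles, val z \in bgcomp (K i) p
                                & h = (\pi_(Quotient.quot boundary_pred) z)%qT >].

Fact cohomology_comp_closed p : zmod_closed (cohomology_comp_pred p).
Proof.
split=> [|h k].
  by rewrite unfold_in; apply/asboolP; exists 0; rewrite ?raddf0 ?rpred0.
rewrite !unfold_in => /asboolP[z zp ->] /asboolP[t tp ->].
by apply/asboolP; exists (z - t); rewrite ?raddfB ?rpredB.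
Qed.
HB.instance Definition _ p :=
  GRing.isZmodClosed.Build cohomology_group (cohomology_comp_pred p)
    (cohomology_comp_closed p).

Definition cohomology : bgmod :=
  @BGMod cohomology_group (fun p => cohomology_comp_pred p).

End Cohomology.

(** * Graded dimension *)

Definition biadditive (M N P : zmodType) (f : M -> N -> P) : Prop :=
  (forall m1 m2 n, f (m1 + m2) n = f m1 n + f m2 n) /\
  (forall m n1 n2, f m (n1 + n2) = f m n1 + f m n2).

(* [t] exhibits V as the rational vector space M (x)_Z Q. *)
Definition is_tensorQ (M : zmodType) (V : lmodType rat) (t : M -> rat -> V) :
    Prop :=
  [/\ biadditive t, forall m a b, t m (a * b) = a *: t m b
    & forall (W : zmodType) (f : M -> rat -> W), biadditive f ->
        exists g : {additive V -> W},
          (forall m a, g (t m a) = f m a) /\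
          (forall h : {additive V -> W},
             (forall m a, h (t m a) = f m a) -> h =1 g)].

(* dim_Q (M (x) Q), by convention 0 if it is infinite. *)
Definition dimQ (M : zmodType) : nat :=
  xget 0%N [set n : nat | exists t : M -> rat -> 'rV[rat]_n, is_tensorQ t]%classic.

(* A field containing the Laurent polynomials Z[x, x^-1, y, y^-1]. *)
Definition QF := {fraction {poly {poly int}}}.
Definition qx : QF := tofrac 'X%:P.
Definition qy : QF := tofrac 'X.

(* The sum is, by convention, 0 when it has infinite support. *)
Definition qdim (M : bgmod) : QF :=
  \sum_(p \in [set: int * int]%classic)
    qx ^ p.1 * qy ^ p.2 * (dimQ (zsub (bgcomp M p)))%:R.

(** * The Tutte complex *)

(* A = Z[x]/(x^2), and also B = Z[y]/(y^2); 'qX is the class of the variable,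
   and a`_0, a`_1 are the coordinates of a in the basis (1, 'qX). *)
Definition algA := {poly %/ ('X^2 : {poly int})}.
HB.instance Definition _ := GRing.ComNzRing.on algA.
Definition modB := {poly %/ ('X^2 : {poly int})}.
HB.instance Definition _ := GRing.ComNzRing.on modB.

Section TutteComplex.
Variable G : mgraph.
Implicit Types s t : {set edge G}.

Definition component s := {E : {set vertex G} | E \in components s}.

(* (f, g) stands for the basis element
   (\bigotimes_E x ^ f E) (x) (\bigotimes_k y ^ g k). *)
Definition monomial s :=
  ({ffun component s -> 'I_2} * {ffun 'I_(b1 s) -> 'I_2})%type.

(* C^s(G), the free Z-module on the tensor products of basis elements. *)
Definition Cs s := {ffun monomial s -> int}.
HB.instance Definition _ s := GRing.Zmodule.on (Cs s).

Definition bideg s (m : monomial s) : int * int :=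
  ((\sum_E m.1 E)%N%:Z, (\sum_k m.2 k)%N%:Z).

Definition pure s (a : component s -> algA) (b : 'I_(b1 s) -> modB) : Cs s :=
  [ffun m : monomial s =>
     (\prod_E (a E : {poly int})`_(m.1 E)) *
     (\prod_k (b k : {poly int})`_(m.2 k))].

(* The component F of [G : t] gets the product of the a_E for the components
   E of [G : s] which it contains: when t is s with one more edge, either two
   factors are multiplied or this is the identity. *)
Definition push_A s t (a : component s -> algA) (F : component t) : algA :=
  \prod_(E : component s | val E \subset val F) a E.

(* b |-> b (x) 1 (x) ... (x) 1; when t is s with one more edge, there is one
   factor 1 if the edge joins a component to itself, and none otherwise. *)
Definition push_B s t (b : 'I_(b1 s) -> modB) (k : 'I_(b1 t)) : modB :=
  oapp b 1 (insub (val k)).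

(* The per-edge map, for t = s with one more edge: the additive map which sends
   pure a b to pure (push_A a) (push_B b), see dedge_pure. *)
Definition dedge s t (u : Cs s) : Cs t :=
  \sum_(m : monomial s)
    pure (push_A (fun E => 'qX ^+ m.1 E)) (push_B (fun k => 'qX ^+ m.2 k)) *~ u m.

Fact dedge_additive s t : zmod_morphism (@dedge s t).
Proof.
move=> u v; rewrite /dedge -sumrB; apply: eq_bigr => m _.
by rewrite !ffunE mulrzBr.
Qed.
HB.instance Definition _ s t :=
  GRing.isZmodMorphism.Build (Cs s) (Cs t) (@dedge s t) (@dedge_additive s t).

Lemma adj_sym s : symmetric (adj s).
Proof. by move=> u v; apply: eq_existsb => e; rewrite finset.setUC. Qed.

Lemma mem_components s E :
  E \in components s <-> exists x, E = [set y | connect (adj s) x y].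
Proof.
split=> [/imsetP[x _ ->]|[x ->]].
  by exists x; apply/setP=> y; rewrite !inE.
by apply/imsetP; exists x => //; apply/setP=> y; rewrite !inE.
Qed.

Lemma connect_adjU1 s e u v x y : ends e = [set u; v] ->
  connect (adj (e |: s)) x y ->
  [|| connect (adj s) x y, connect (adj s) x u && connect (adj s) v y
    | connect (adj s) x v && connect (adj s) u y].
Proof.
move=> he /connectP[p + ->]; elim/last_ind: p => [|p z IH] /=.
  by rewrite connect0.
rewrite rcons_path last_rcons => /andP[/IH {}IH].
have cs := sym_connect_sym (@adj_sym s).
move=> /existsP[f /andP[]]; rewrite !inE => /orP[/eqP->|fs hf].
  rewrite he => /eqP huv.
  have : last x p \in [set u; v] by rewrite huv !inE eqxx.
  have : z \in [set u; v] by rewrite huv !inE eqxx orbT.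
  rewrite !inE => /orP[]/eqP-> /orP[]/eqP hl; rewrite hl in IH *;
    rewrite !connect0 ?andbT; case/or3P: IH => //;
    try (by move=> ->; rewrite ?orbT);
    try by case/andP=> -> _; rewrite ?orbT.
have lz : connect (adj s) (last x p) z.
  by apply: connect1; apply/existsP; exists f; rewrite fs.
case/or3P: IH => [h|/andP[h1 h2]|/andP[h1 h2]].
- by rewrite (connect_trans h lz).
- by rewrite h1 (connect_trans h2 lz) orbT.
- by rewrite h1 (connect_trans h2 lz) !orbT.
Qed.

Lemma sub_connect_adj s t x y : s \subset t ->
  connect (adj s) x y -> connect (adj t) x y.
Proof.
move=> st; apply: connect_sub => {}x {}y /existsP[e /andP[es he]].
by apply: connect1; apply/existsP; exists e; rewrite (fintype.subsetP st).
Qed.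

Lemma comp_sub s t (E : component s) : s \subset t ->
  exists F : component t, forall F' : component t, (val E \subset val F') = (F == F').
Proof.
move=> st; have [x hE] := (mem_components s (val E)).1 (valP E).
have hF : [set y | connect (adj t) x y] \in components t.
  by apply/mem_components; exists x.
exists (exist (fun E => E \in components t) _ hF : component t) => F'; have [z hF'] := (mem_components t (val F')).1 (valP F').
have ct := sym_connect_sym (@adj_sym t).
apply/idP/eqP => [/fintype.subsetP/(_ x)|<-].
  rewrite hE hF' !inE connect0 => /(_ isT) zx.
  apply/val_inj; rewrite /= hF'; apply/setP=> y; rewrite !inE.
  by rewrite (same_connect ct zx).
by apply/fintype.subsetP => y; rewrite hE !inE; apply: sub_connect_adj.
Qed.

Lemma b0_setU1 s e : (b0 s <= (b0 (e |: s)).+1)%N.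
Proof.
have [u [v he]] : exists u v, ends e = [set u; v].
  have /andP[h0] := card_ends e; rewrite leq_eqVlt ltnS.
  case/orP=> [/cards2P[u [v [_ ->]]]|h1]; first by exists u, v.
  have /cards1P[u ->] : #|ends e| == 1%N by rewrite eqn_leq h1.
  by exists u, u; rewrite finset.setUid.
set U := [set y | connect (adj s) u y].
have hU : U \in components s by apply/mem_components; exists u.
rewrite {1}/b0 (cardsD1 U) hU add1n ltnS.
pose f (E : {set vertex G}) := \bigcup_(x in E) [set y | connect (adj (e |: s)) x y].
have ct := sym_connect_sym (@adj_sym (e |: s)).
have cs := sym_connect_sym (@adj_sym s).
have st : s \subset e |: s by apply: finset.subsetUr.
have fE x : f [set y | connect (adj s) x y] = [set y | connect (adj (e |: s)) x y].
  apply/setP=> y; apply/bigcupP/idP => [[z]|hy].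
    by rewrite !inE => /(sub_connect_adj st)/(same_connect ct) ->.
  by exists x; rewrite // inE connect0.
rewrite -(card_in_imset (f := f)) /b0.
  apply: subset_leq_card; apply/fintype.subsetP=> F /imsetP[E].
  rewrite !inE => /andP[_ /mem_components[x ->]] ->.
  by apply/mem_components; exists x; rewrite fE.
move=> E1 E2; rewrite !inE => /andP[n1 /mem_components[x h1]].
move=> /andP[n2 /mem_components[y h2]].
have nu z E : E != U -> E = [set y | connect (adj s) z y] ->
    connect (adj s) z u = false.
  move=> nE hE; apply: contraNF nE => zu; rewrite hE; apply/eqP/setP=> w.
  by rewrite !inE (same_connect cs zu).
have xu := nu _ _ n1 h1; have yu := nu _ _ n2 h2.
rewrite h1 h2 !fE => /setP/(_ y); rewrite !inE connect0.
move=> /(connect_adjU1 he); rewrite xu (cs u) yu andbF !orbF => xy.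
by apply/setP=> w; rewrite !inE (same_connect cs xy).
Qed.

Lemma b1_setU1 s e : e \notin s -> (b1 s <= b1 (e |: s))%N.
Proof.
move=> es; rewrite /b1 cardsU1 es leq_sub2r // addSn -addnS leq_add2l.
exact: b0_setU1.
Qed.

Lemma coefA_mulrz (x : algA) z k :
  ((x *~ z : algA) : {poly int})`_k = (x : {poly int})`_k *~ z.
Proof.
have cD (y y' : algA) : ((y + y' : algA) : {poly int})`_k =
    (y : {poly int})`_k + (y' : {poly int})`_k by exact: coefD.
have cN (y : algA) : ((- y : algA) : {poly int})`_k = - (y : {poly int})`_k.
  exact: coefN.
have cn (y : algA) n : ((y *+ n : algA) : {poly int})`_k = (y : {poly int})`_k *+ n.
  by elim: n => [|n IH]; rewrite ?mulr0n ?coef0 // !mulrS cD IH.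
by case: z => n; rewrite ?NegzE ?mulrNz -!pmulrn ?cN cn.
Qed.

Lemma coefA_sum (I : Type) (r : seq I) (P : pred I) (F : I -> algA) k :
  ((\sum_(i <- r | P i) F i : algA) : {poly int})`_k =
  \sum_(i <- r | P i) (F i : {poly int})`_k.
Proof. exact: coefn_sum. Qed.

Lemma coord_qpoly (a : algA) :
  a = \sum_(c < 2) 'qX ^+ c *~ (a : {poly int})`_c.
Proof.
have size2 : size (mk_monic ('X^2 : {poly int})) = 3.
  by rewrite mk_monic_Xn size_polyXn.
apply/val_inj/polyP=> k; rewrite [RHS]coefA_sum big_ord_recl big_ord1.
rewrite !coefA_mulrz expr0 expr1.
rewrite in_qpoly_small; last by rewrite size2 size_polyX.
rewrite -[_`_k in X in _ = X + _]/((1%:P : {poly int})`_k).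
rewrite coefC coefX; case: k => [|[|k]] /=;
  rewrite ?mul0rz ?addr0 ?add0r ?intz //.
by rewrite nth_default // (leq_trans (size_npoly a)) // size2.
Qed.

Lemma expand_tensor (I J : finType) (p : I -> J) (a : I -> algA)
    (m : {ffun J -> 'I_2}) :
  \prod_j ((\prod_(i | p i == j) a i : algA) : {poly int})`_(m j) =
  \sum_(f : {ffun I -> 'I_2})
    (\prod_j ((\prod_(i | p i == j) 'qX ^+ f i : algA) : {poly int})`_(m j)) *
    \prod_i (a i : {poly int})`_(f i).
Proof.
pose Fm (f : {ffun I -> 'I_2}) j : int :=
  ((\prod_(i | p i == j) 'qX ^+ f i : algA) : {poly int})`_(m j) *
   \prod_(i | p i == j) (a i : {poly int})`_(f i).
pose Q (j : J) := pfamily (ord0 : 'I_2) (fun i => p i == j) (fun _ => predT).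
transitivity (\prod_j \sum_(f in Q j) Fm f j).
  apply: eq_bigr => j _.
  rewrite (eq_bigr (fun i => \sum_(c < 2) 'qX ^+ c *~ (a i : {poly int})`_c));
    last by move=> i _; exact: coord_qpoly.
  rewrite (big_distr_big_dep ord0) coefA_sum.
  apply: eq_bigr => f _.
  have -> : \prod_(i | p i == j) ('qX ^+ f i *~ (a i : {poly int})`_(f i)) =
      (\prod_(i | p i == j) 'qX ^+ f i : algA) *~
      \prod_(i | p i == j) (a i : {poly int})`_(f i).
    elim/big_rec3: _ => [|i z y x _ ->]; first by rewrite mulr1z.
    by rewrite mulrzAl mulrzAr -mulrzA [X in _ *~ X]mulrC.
  by rewrite coefA_mulrz -mulrzr intz.
rewrite bigA_distr_big_dep.
pose h (f : {ffun I -> 'I_2}) : {ffun J -> {ffun I -> 'I_2}} :=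
  [ffun j => [ffun i => if p i == j then f i else ord0]].
pose h' (g : {ffun J -> {ffun I -> 'I_2}}) : {ffun I -> 'I_2} :=
  [ffun i => g (p i) i].
rewrite (reindex_onto h h') /=; last first.
  move=> g /familyP gQ; apply/ffunP=> j; apply/ffunP=> i; rewrite !ffunE.
  case: eqP => [->//|pij]; have /pfamilyP[/fintype.subsetP/(_ i) + _] := gQ j.
  by rewrite !inE; case: eqP => // _ /contraR/(_ (introN eqP pij))/eqP.
apply: eq_big => [f|f _].
  have -> : h' (h f) = f by apply/ffunP=> i; rewrite !ffunE eqxx.
  rewrite eqxx andbT; apply/familyP=> j; apply/pfamilyP; split=> //.
  apply/fintype.subsetP=> i; rewrite !unfold_in /= !ffunE.
  by case: (p i == j).
rewrite big_split /=; congr (_ * _).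
  apply: eq_bigr => j _.
  suff -> : \prod_(i | p i == j) 'qX ^+ h f j i =
            \prod_(i | p i == j) 'qX ^+ f i :> algA by [].
  by apply: eq_bigr => i ij; rewrite !ffunE ij.
rewrite [RHS](partition_big p predT) //=; apply: eq_bigr => j _.
by apply: eq_bigr => i ij; rewrite !ffunE ij.
Qed.

Lemma dedge_pure s e (a : component s -> algA) (b : 'I_(b1 s) -> modB) : e \notin s ->
  dedge (e |: s) (pure a b) = pure (push_A a) (push_B b).
Proof.
move=> es; set t := e |: s.
have st : s \subset t by apply: finset.subsetUr.
have [p hp] := fin_all_exists (fun E : component s => comp_sub E st).
pose q := widen_ord (b1_setU1 es).
have pA a' F : push_A a' F = \prod_(E | p E == F) a' E.
  by apply: eq_bigl => E; rewrite hp.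
have pB b' k : push_B b' k = \prod_(l | q l == k) b' l.
  rewrite /push_B; case: insubP => [l _ lk|/= hk].
    have -> : k = q l by apply/val_inj.
    by rewrite (big_pred1 l) //= => l'; rewrite -!val_eqE.
  rewrite big1 // => l /eqP lk; case/negP: hk.
  by rewrite -lk /= ltn_ord.
apply/ffunP=> m; rewrite /dedge sum_ffunE ffunE.
under eq_bigr => E _ do rewrite pA.
rewrite expand_tensor.
under [X in _ * X]eq_bigr => k _ do rewrite pB.
rewrite [X in _ * X]expand_tensor big_distrlr pair_bigA /=.
apply: eq_bigr => m' _; rewrite ffunMzE !ffunE -mulrzr intz.
rewrite mulrACA; congr ((_ * _) * (_ * _)); apply: eq_bigr => i _.
  by rewrite pA.
by rewrite pB.
Qed.

Section Complex.
Variable o : 'I_#|edge G| -> edge G.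

Definition sets_of_size (i : nat) := {s : {set edge G} | #|s| == i}.

Definition Ci (i : nat) : zmodType :=
  dsum (fun s : sets_of_size i => Cs (val s) : zmodType).

Definition Ci_comp_pred i (p : int * int) : {pred Ci i} :=
  fun u => [forall s, forall m, (u s m != 0) ==> (bideg m == p)].

Definition edge_sign s (j : 'I_#|edge G|) : int :=
  (-1) ^+ #|[set k : 'I_#|edge G| | (k < j)%N & o k \in s]|.

(* The coordinate of d u at t, the map d being the sum, over all s and j with
   o j \notin s, of the maps C^s -> C^(o j |: s). *)
Definition tutte_diff i (u : Ci i) : Ci i.+1 :=
  finfun (fun t : sets_of_size i.+1 =>
    \sum_(s : sets_of_size i)
      \sum_(j | (o j \notin val s) && (o j |: val s == val t))
        dedge (val t) (u s) *~ edge_sign (val s) j).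

Fact Ci_comp_closed i p : zmod_closed (@Ci_comp_pred i p).
Proof.
split=> [|u v /forallP hu /forallP hv].
  by apply/forallP=> s; apply/forallP=> m; rewrite ffunE ffunE eqxx.
apply/forallP=> s; apply/forallP=> m; apply/implyP; apply: contraR => mp.
have /forallP/(_ m) := hu s; have /forallP/(_ m) := hv s.
rewrite (negPf mp) !implybF !negbK => /eqP hv0 /eqP hu0.
by rewrite !ffunE hu0 hv0 subrr.
Qed.
HB.instance Definition _ i p :=
  GRing.isZmodClosed.Build (Ci i) (@Ci_comp_pred i p) (@Ci_comp_closed i p).

Fact tutte_diff_additive i : zmod_morphism (@tutte_diff i).
Proof.
move=> u v; apply/ffunP=> t; rewrite !ffunE -sumrB.
apply: eq_bigr => s _; rewrite -sumrB; apply: eq_bigr => j _.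
by rewrite !ffunE -mulrzBl raddfB.
Qed.
HB.instance Definition _ i :=
  GRing.isZmodMorphism.Build (Ci i) (Ci i.+1) (@tutte_diff i)
    (@tutte_diff_additive i).

Definition tutte_complex : cochain :=
  @Cochain (fun i => @BGMod (Ci i) (fun p => @Ci_comp_pred i p))
           (fun i => @tutte_diff i).

End Complex.
End TutteComplex.

(* Main.v *)
From HB Require Import structures.
Require Import Defs.
From mathcomp Require Import all_boot all_order all_algebra.
From mathcomp Require Import boolp classical_sets cardinality fsbigop.
From mathcomp Require Import ring.

Set Implicit Arguments.
Unset Strict Implicit.
Unset Printing Implicit Defensive.

Import Order.TTheory GRing.Theory Num.Theory.
Local Open Scope ring_scope.

(* The composite of two per-edge maps C^s -> C^(s+e) -> C^(s+e+f) depends only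
   on s+e+f, and the two orders of adding e and f carry opposite signs, so
   d o d = 0.  Two orderings of the edges give isomorphic complexes: multiply
   C^s by the sign of the permutation of s which compares them.  In each
   bidegree, the rank of H^i plus the ranks of the differentials into and out of
   C^i is the rank of C^i, so the alternating sums agree; C^s has graded
   dimension (1+x)^(b0 s) (1+y)^(b1 s), whence the polynomial. *)

(** [dimQ] is specified by a universal property and cohomology may have torsion, so no tensor
    product is built: a rank is read off any additive map to a rational row space whose kernel is
    torsion and whose image contains a positive multiple of every vector. For cohomology such a map
    is assembled from representing cycles, which are additive only up to coboundaries. The type
    [Cs s] depends on the edge set [s]. Since [dedge] is defined between arbitrary edge sets and the
    differential sums over all source sets, two paths from [s] to the same target give maps of one
    and the same type, and no transport along equalities of sets occurs. A reordering is treated as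
    the identity isomorphism of the graph, so one transport argument gives both invariance claims.
    The comparing sign counts inversions: adding an edge changes it by exactly the ratio of the two
    edge signs. *)

(** * Rational rank of an abelian group *)

(* Such a map identifies M (x) Q with Q^n. *)
Definition rational_chart (M : zmodType) n (tau : {additive M -> 'rV[rat]_n}) :
    Prop :=
  (forall m, tau m = 0 -> exists2 k, (0 < k)%N & m *+ k = 0) /\
  (forall v, exists k m, (0 < k)%N /\ tau m = v *+ k).

Lemma biadditive_muln (M N P : zmodType) (f : M -> N -> P) :
  biadditive f -> forall m n k, f (m *+ k) n = f m n *+ k /\ f m (n *+ k) = f m n *+ k.
Proof.
move=> [fl fr] m n k.
have f0l x : f 0 x = 0 by apply: (addrI (f 0 x)); rewrite -fl !addr0.
have f0r x : f x 0 = 0 by apply: (addrI (f x 0)); rewrite -fr !addr0.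
by elim: k => [|k [IH1 IH2]]; rewrite ?mulr0n // !mulrS fl fr IH1 IH2.
Qed.

(** Writing [a] as [k] times [a / k] moves the factor [k] onto [m], where it kills. *)
Lemma biadditive_rat_torsion (M P : zmodType) (f : M -> rat -> P) m k :
  biadditive f -> (0 < k)%N -> m *+ k = 0 -> forall a, f m a = 0.
Proof.
move=> hf k0 mk a; have k0' : k%:R != 0 :> rat by rewrite pnatr_eq0 -lt0n.
have -> : a = (a / k%:R) *+ k by rewrite -mulr_natr divfK.
rewrite (biadditive_muln hf _ _ _).2 -(biadditive_muln hf _ _ _).1 mk.
by rewrite -(mulr0n m) (biadditive_muln hf _ _ _).1 mulr0n.
Qed.

Lemma biadditive_sub (M N P : zmodType) (f : M -> N -> P) :
  biadditive f -> forall m m' n, f (m - m') n = f m n - f m' n.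
Proof. by move=> [fl _] m m' n; apply: (addIr (f m' n)); rewrite -fl !subrK. Qed.

(** Denominators are cleared: if [v *+ k] is the image of [m], the induced map must send [v] to
    [f m k^-1], and this does not depend on [k] and [m] because [f] vanishes on torsion. *)
Lemma chart_tensorQ (M : zmodType) n (tau : {additive M -> 'rV[rat]_n}) :
  rational_chart tau -> is_tensorQ (fun m a => a *: tau m).
Proof.
move=> [tor span]; split=> [|m a b|W f hf].
- by split=> [m1 m2 a|m a b]; rewrite ?raddfD ?scalerDr ?scalerDl.
- by rewrite scalerA.
have nz k : (0 < k)%N -> k%:R != 0 :> rat by rewrite pnatr_eq0 -lt0n.
have [kv /choice[mv kmP]] := choice span.
have kv0 v : (0 < kv v)%N by case: (kmP v).
have mvE v : tau (mv v) = v *+ kv v by case: (kmP v).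
have canc m m' : tau m = tau m' -> forall a, f m a = f m' a.
  move=> e a; have /tor[k k0 hk] : tau (m - m') = 0 by rewrite raddfB e subrr.
  apply/eqP; rewrite -subr_eq0 -(biadditive_sub hf).
  by rewrite (biadditive_rat_torsion hf k0 hk).
pose g v := f (mv v) (kv v)%:R^-1.
have gE v k m : (0 < k)%N -> tau m = v *+ k -> g v = f m k%:R^-1.
  move=> k0 e; rewrite /g.
  have E1 : (kv v)%:R^-1 = ((kv v * k)%N%:R^-1 : rat) *+ k.
    by rewrite -[RHS]mulr_natr natrM invfM divfK ?nz.
  have E2 : k%:R^-1 = ((kv v * k)%N%:R^-1 : rat) *+ kv v.
    by rewrite -[RHS]mulr_natr natrM invfM mulrAC mulVf ?nz ?mul1r.
  rewrite E1 E2 !(biadditive_muln hf _ _ _).2 -!(biadditive_muln hf _ _ _).1.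
  by apply: canc; rewrite !raddfMn mvE e -!mulrnA mulnC.
have gB : zmod_morphism g.
  (* Additivity is checked over the common denominator [kv v * kv w]. *)
  move=> v w; rewrite (gE (v - w) (kv v * kv w)%N (mv v *+ kv w - mv w *+ kv v)).
  - rewrite (gE v (kv v * kv w)%N (mv v *+ kv w)).
    + rewrite (gE w (kv v * kv w)%N (mv w *+ kv v)) ?muln_gt0 ?kv0 //.
        by rewrite -(biadditive_sub hf).
      by rewrite raddfMn mvE -mulrnA mulnC.
    + by rewrite muln_gt0 !kv0.
    + by rewrite raddfMn mvE -mulrnA.
  - by rewrite muln_gt0 !kv0.
  - by rewrite raddfB ![tau (_ *+ _)]raddfMn !mvE -!mulrnA [(kv w * _)%N]mulnC -mulrnBl.
pose ga : {additive 'rV[rat]_n -> W} :=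
  HB.pack g (GRing.isZmodMorphism.Build _ _ g gB).
exists ga; split=> [m a|h hh v] /=.
  rewrite -[a]divq_num_den; set q := denq a; have := denq_gt0 a; rewrite -/q.
  case: q => // q; rewrite ltz_nat => q0.
  (* The integer numerator moves to the module argument, which leaves a fraction of the form treated
     by [gE]. *)
  have fz z : f m (z%:~R / q%:R) = f (m *~ z) q%:R^-1.
    have fN x b : f (- x) b = - f x b.
      by rewrite -sub0r (biadditive_sub hf) -(mulr0n m)
        (biadditive_muln hf _ _ _).1 mulr0n sub0r.
    have fN' x b : f x (- b) = - f x b.
      apply: (addrI (f x b)); rewrite -hf.2 !subrr.
      by rewrite -(mulr0n (1 : rat)) (biadditive_muln hf _ _ _).2 mulr0n.
    case: z => z; rewrite ?NegzE ?mulrNz -?pmulrn.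
      by rewrite mulrC mulr_natr (biadditive_muln hf _ _ _).2
        (biadditive_muln hf _ _ _).1.
    by rewrite mulNr fN fN' mulrC mulr_natr (biadditive_muln hf _ _ _).2
        (biadditive_muln hf _ _ _).1.
  rewrite -pmulrn fz; apply: gE => //.
  rewrite raddfMz -scaler_nat scalerA mulrCA divff ?nz // mulr1.
  by rewrite -scaler_int.
rewrite /g -hh mvE -scaler_nat scalerA mulVf ?scale1r // nz //.
Qed.

(** Additive maps between rational vector spaces are automatically linear. *)
Lemma additive_rat_mx m n (g : {additive 'rV[rat]_m -> 'rV[rat]_n}) :
  exists G : 'M_(m, n), forall v, g v = v *m G.
Proof.
have gl : linear g by move=> a x y; rewrite raddfD (rat_linear (raddfB g)).
pose G : {linear 'rV[rat]_m -> 'rV[rat]_n} :=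
  HB.pack (g : _ -> _) (GRing.isLinear.Build _ _ _ _ (g : _ -> _) gl).
by exists (lin1_mx G) => v; rewrite mul_rV_lin1.
Qed.

(** The comparison maps given by the two universal properties compose to the identity, so their
    matrices satisfy [G *m G' = 1], which bounds one size by the other. *)
Lemma tensorQ_linear_dim (M : zmodType) m n (t : M -> rat -> 'rV[rat]_m)
    (t' : M -> rat -> 'rV[rat]_n) : is_tensorQ t -> is_tensorQ t' -> m = n.
Proof.
suff le m' n' (u : M -> rat -> 'rV[rat]_m') (u' : M -> rat -> 'rV[rat]_n') :
    is_tensorQ u -> is_tensorQ u' -> (m' <= n')%N.
  by move=> ht ht'; apply/eqP; rewrite eqn_leq (le _ _ _ _ ht ht') (le _ _ _ _ ht' ht).
move=> [ub us uu] [ub' us' uu'].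
have [g [gE _]] := uu _ _ ub'; have [g' [gE' _]] := uu' _ _ ub.
have [i [iE iu]] := uu _ _ ub.
have gg x : g' (g x) = x.
  have -> : g' (g x) = i x.
    by apply: (iu (g' \o g : {additive _ -> _})) => y a /=; rewrite gE gE'.
  by rewrite -(iu (idfun : {additive 'rV[rat]_m' -> 'rV[rat]_m'})).
have [[G hG] [G' hG']] := (additive_rat_mx g, additive_rat_mx g').
apply: (@mulmx1_min _ _ _ G G'); apply/row_matrixP=> k.
by rewrite !rowE mulmxA -hG -hG' gg mulmx1.
Qed.

Lemma dimQ_chart (M : zmodType) n (tau : {additive M -> 'rV[rat]_n}) :
  rational_chart tau -> dimQ M = n.
Proof.
move=> ht; apply: xget_unique => [|k [t tk]].
  by exists (fun m a => a *: tau m); apply: chart_tensorQ.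
exact: tensorQ_linear_dim tk (chart_tensorQ ht).
Qed.

Lemma chart_linearization (M N : zmodType) m n
    (tau : {additive M -> 'rV[rat]_m}) (sigma : {additive N -> 'rV[rat]_n})
    (d : {additive M -> N}) :
  rational_chart tau -> exists D : 'M_(m, n), forall x, sigma (d x) = tau x *m D.
Proof.
move=> /chart_tensorQ[_ _ uu].
have [|g [gE _]] := uu _ (fun x a => a *: sigma (d x)).
  by split=> *; rewrite ?raddfD ?scalerDr ?scalerDl.
have [D hD] := additive_rat_mx g.
by exists D => x; rewrite -hD -[tau x]scale1r gE scale1r.
Qed.

Lemma mulmxMnl (R : pzRingType) m n p (A : 'M[R]_(m, n)) (B : 'M[R]_(n, p)) k :
  (A *+ k) *m B = (A *m B) *+ k.
Proof. by rewrite -[LHS]/(mulmxr B (A *+ k)) raddfMn. Qed.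

(* [rep] picks a cycle in each homology class. *)
Lemma homology_chart (M0 M1 M2 H : zmodType) n0 n1 n2
    (tau0 : {additive M0 -> 'rV[rat]_n0}) (tau1 : {additive M1 -> 'rV[rat]_n1})
    (tau2 : {additive M2 -> 'rV[rat]_n2})
    (d1 : {additive M0 -> M1}) (d2 : {additive M1 -> M2})
    (D1 : 'M_(n0, n1)) (D2 : 'M_(n1, n2)) (rep : H -> M1) :
  rational_chart tau0 -> rational_chart tau1 -> rational_chart tau2 ->
  (forall x, tau1 (d1 x) = tau0 x *m D1) ->
  (forall x, tau2 (d2 x) = tau1 x *m D2) ->
  (forall x, d2 (d1 x) = 0) ->
  (forall h, d2 (rep h) = 0) ->
  (forall h k, exists a, rep (h - k) - (rep h - rep k) = d1 a) ->
  (forall h a, rep h = d1 a -> h = 0) ->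
  (forall z, d2 z = 0 -> exists h a, rep h - z = d1 a) ->
  (dimQ H + \rank D2 + \rank D1 = n1)%N.
Proof.
move=> [tor0 sp0] [tor1 sp1] [tor2 sp2] hD1 hD2 dd repZ repB repI repS.
(* Each basis vector has a positive multiple in the image of [tau0], where [d2 (d1 x) = 0]
   applies. *)
have D12 : D1 *m D2 = 0.
  apply/row_matrixP=> i; rewrite row0 row_mul.
  have [k [m [k0 e]]] := sp0 (delta_mx 0 i); apply/eqP.
  have : (row i D1 *m D2) *+ k = 0.
    by rewrite rowE -!mulmxMnl -e -hD1 -hD2 dd raddf0.
  by move/eqP; rewrite -scaler_nat scaler_eq0 pnatr_eq0 eqn0Ngt k0.
(* [K] spans the rational cycles and [P] divides by the row space of [D1], so [B] is a basis of
   rational homology. *)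
pose K := kermx D2; pose P := cokermx D1; pose B := row_base (K *m P).
have sub1 : (D1 <= K)%MS by apply/sub_kermxP.
have rB : (\rank (K *m P) + \rank D2 + \rank D1 = n1)%N.
  have e1 := mxrank_mul_ker K P.
  have e2 : (K :&: kermx P :=: D1)%MS.
    apply/eqmxP; rewrite sub_capmx sub1 andTb; apply/andP; split.
      apply: submx_trans (capmxSr _ _) _.
      by rewrite submxE mulmx_ker.
    by apply/sub_kermxP; rewrite mulmx_coker.
  have e3 := mxrank_ker D2; have e4 := rank_leq_row D2.
  rewrite e2 in e1; rewrite addnAC e1 e3 subnK //.
have inP (v : 'rV_n1) : v *m P = 0 -> (v <= D1)%MS by move=> h; rewrite submxE h.
have inB (v : 'rV_n1) : v *m D2 = 0 -> (v *m P <= B)%MS.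
  by move=> h; rewrite eq_row_base submxMr //; apply/sub_kermxP.
(* The chart of [H]: coordinates in the basis [B] of the class of a representing cycle. *)
pose sg (h : H) := tau1 (rep h) *m P *m pinvmx B.
have rep2 h : tau1 (rep h) *m D2 = 0 by rewrite -hD2 repZ raddf0.
have bd0 a : tau1 (d1 a) *m P = 0.
  by rewrite hD1 -mulmxA mulmx_coker mulmx0.
have sgB : zmod_morphism sg.
  move=> h k; rewrite /sg; have [a e] := repB h k.
  have -> : rep (h - k) = d1 a + (rep h - rep k) by rewrite -e subrK.
  by rewrite raddfD mulmxDl bd0 add0r raddfB !mulmxBl.
pose sga : {additive H -> 'rV[rat]_(\rank (K *m P))} :=
  HB.pack sg (GRing.isZmodMorphism.Build _ _ sg sgB).
rewrite -[RHS]rB; congr (_ + _ + _)%N; apply: (@dimQ_chart _ _ sga); split=> [h|v] /=.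
  (* Torsion kernel: [tau1 (rep h)] is a rational boundary. The factor [k] makes it the image of an
     actual boundary, and [l] removes the torsion by which the two elements of [M1] still differ. *)
  move=> h0; have : tau1 (rep h) *m P = 0.
    by rewrite -(mulmxKpV (inB _ (rep2 h))) -/sg [X in X *m B]h0 mul0mx.
  move/inP/submxP => [w e]; have [k [a [k0 ea]]] := sp0 w.
  have /tor1[l l0 el] : tau1 (rep h *+ k - d1 a) = 0.
    by rewrite raddfB raddfMn hD1 ea mulmxMnl e subrr.
  exists (k * l)%N; first by rewrite muln_gt0 k0.
  have rep0 : exists a, rep 0 = d1 a.
    have [a' ea'] := repB 0 0; exists a'; rewrite -ea' subr0 subrr subr0 //.
  have repD h1 h2 : exists a, rep (h1 + h2) = rep h1 + rep h2 + d1 a.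
    have [a1 e1] := repB (h1 + h2) h2; exists (- a1).
    by rewrite raddfN -e1 addrK opprB [RHS]addrC addrA !subrK.
  have repn j : exists a, rep (h *+ j) = rep h *+ j + d1 a.
    elim: j => [|j [a' IH]].
      by rewrite !mulr0n; have [a' ->] := rep0; exists a'; rewrite add0r.
    rewrite !mulrS; have [a2 ->] := repD h (h *+ j); rewrite IH.
    by exists (a' + a2); rewrite raddfD !addrA.
  have [a' e'] := repn (k * l)%N.
  apply: (repI _ (a *+ l + a')); rewrite e' raddfD; congr (_ + _).
  by apply/eqP; rewrite raddfMn mulrnA -subr_eq0 -mulrnBl el.
(* Image: [v *m B] lifts to a rational cycle [w *m K]. The factor [k] brings it into the image of
   [tau1], but [d2 z] is then only torsion; the factor [l] turns [z] into a genuine cycle. *)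
have : (v *m B <= K *m P)%MS by rewrite -(eq_row_base (K *m P)) submxMl.
case/submxP=> w; rewrite mulmxA => ew.
have wK : w *m K *m D2 = 0 by rewrite -mulmxA mulmx_ker mulmx0.
have [k [z [k0 ez]]] := sp1 (w *m K).
have /tor2[l l0 el] : tau2 (d2 z) = 0 by rewrite hD2 ez mulmxMnl wK mul0rn.
have [|h [a ha]] := repS (z *+ l); first by rewrite raddfMn.
exists (k * l)%N, h; split; first by rewrite muln_gt0 k0.
rewrite /sg; have -> : rep h = d1 a + z *+ l by rewrite -ha subrK.
rewrite raddfD mulmxDl bd0 add0r raddfMn ez !mulmxMnl -ew -mulrnA.
by rewrite (mulmxKp (row_base_free _)).
Qed.

(** * Gradings and the Euler characteristic *)

Lemma zsub_map (M N : zmodType) (S : zmodClosed M) (T : zmodClosed N)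
    (f : {additive M -> N}) : (forall u, u \in S -> f u \in T) ->
  exists g : {additive zsub S -> zsub T}, forall u, val (g u) = f (val u).
Proof.
move=> fST; pose g (u : zsub S) : zsub T := ZSub (fST _ (zvalP u)).
have gB : zmod_morphism g by move=> u v; apply/val_inj; rewrite /= !raddfB.
pose ga : {additive zsub S -> zsub T} :=
  HB.pack g (GRing.isZmodMorphism.Build _ _ g gB).
by exists ga.
Qed.

Lemma dimQ_trivial (M : zmodType) : (forall m : M, m = 0) -> dimQ M = 0%N.
Proof.
move=> M0; apply: (@dimQ_chart M 0 (\0 : {additive M -> 'rV[rat]_0})).
split=> [m _|v]; first by exists 1%N; rewrite // [m]M0.
by exists 1%N, 0; rewrite [v]thinmx0 mul0rn.
Qed.

Lemma fsbigT_seq (V : nmodType) (T : choiceType) (r : seq T) (F : T -> V) :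
  uniq r -> (forall i, i \notin r -> F i = 0) ->
  \sum_(i \in [set: T]%classic) F i = \sum_(i <- r) F i.
Proof.
move=> ur F0; rewrite (@fsbigE _ _ _ _ _ r) //; last by move=> i _; apply: F0.
by apply: eq_bigl => i; rewrite in_setT.
Qed.

Lemma sum_if_eq_seq (V : nmodType) (T : eqType) (r : seq T) p (x : V) :
  uniq r -> p \in r -> \sum_(q <- r) (if q == p then x else 0) = x.
Proof.
move=> ur rp; rewrite (bigD1_seq p) //= eqxx big1 ?addr0 // => q.
by move=> /negPf->.
Qed.

(** Projections, unlike the unique families in [bigraded], can be composed with differentials and
    passed to quotients; the finite list turns the sums over all bidegrees into ordinary ones. *)
Definition graded_by (M : bgmod) (X : seq (int * int))
    (pr : int * int -> {additive M -> M}) : Prop :=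
  [/\ uniq X, forall p u, pr p u \in bgcomp M p,
      forall p q u, u \in bgcomp M p -> pr q u = if q == p then u else 0
    & forall u, u = \sum_(p <- X) pr p u].

Lemma graded_out M X pr : @graded_by M X pr ->
  forall p u, p \notin X -> u \in bgcomp M p -> u = 0.
Proof.
move=> [_ _ prE sumE] p u pX up; rewrite [LHS]sumE big1_seq // => q /= qX.
by rewrite (prE p) //; case: eqP qX pX => // -> ->.
Qed.

Lemma graded_bigraded M X pr : @graded_by M X pr -> bigraded M.
Proof.
move=> gM; have [uX prC prE sumE] := gM.
have pr0 p u : p \notin X -> pr p u = 0.
  by move=> pX; apply: (graded_out gM pX).
move=> u; exists (fun p => pr p u); split=> [|c [cf cC cu]].
  split=> //; last by rewrite (fsbigT_seq uX) // => p; apply: pr0.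
  apply: sub_finite_set (finite_seq X) => p /= /eqP.
  by apply: contra_notT => /pr0 ->.
apply/funext=> p; have [r rE] := (finite_seqP _).1 cf.
have c0 q : q \notin undup r -> c q = 0.
  rewrite mem_undup => qr; apply/eqP; apply: contraNT qr => /eqP cq.
  have : [set` r]%classic q by rewrite -rE; apply/eqP.
  by [].
(* Uniqueness: projecting the given decomposition to bidegree [p] leaves only [c p]. *)
rewrite cu (fsbigT_seq (undup_uniq r) c0) raddf_sum /=.
rewrite (eq_bigr (fun q => if q == p then c p else 0)) => [|q _]; last first.
  by rewrite (prE q) // eq_sym; case: eqP => // ->.
have [pr_|/c0 ->] := boolP (p \in undup r).
  by rewrite sum_if_eq_seq ?undup_uniq.
by rewrite big1 // => q _; case: ifP.
Qed.

Lemma graded_qdim M X pr : @graded_by M X pr ->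
  qdim M = \sum_(p <- X) qx ^ p.1 * qy ^ p.2 * (dimQ (zsub (bgcomp M p)))%:R.
Proof.
move=> gM; apply: fsbigT_seq => [|p pX]; first by case: gM.
rewrite dimQ_trivial ?mulr0 // => u.
exact/val_inj/(graded_out gM pX)/(valP u).
Qed.

(** One list [X] serves all cohomological degrees, so that the Euler characteristic can be computed
    one bidegree at a time. *)
Definition graded_complex (K : cochain) X
    (pr : forall i, int * int -> {additive K i -> K i}) : Prop :=
  [/\ forall i, graded_by X (pr i),
      forall i (u : K i), cdiff K i.+1 (cdiff K i u) = 0
    & forall i p (u : K i), u \in bgcomp (K i) p ->
        cdiff K i u \in bgcomp (K i.+1) p].

(** * Cohomology of a graded complex: induced grading, ranks and alternating sums *)

Section GradedComplex.
Variables (K : cochain) (X : seq (int * int)).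
Variable pr : forall i, int * int -> {additive K i -> K i}.
Hypothesis gK : graded_complex X pr.

Lemma diff_proj i p (u : K i) : cdiff K i (pr i p u) = pr i.+1 p (cdiff K i u).
Proof.
have [gb _ dh] := gK; have [uX prC prE sumE] := gb i.
rewrite {2}[u]sumE !raddf_sum.
rewrite (eq_bigr (fun q => if q == p then cdiff K i (pr i p u) else 0)) => [|q _]; last first.
  have [_ _ prE' _] := gb i.+1.
  rewrite /= (prE' q) ?dh ?prC // eq_sym; by case: eqP => // ->.
have [pX|pX] := boolP (p \in X).
  by rewrite sum_if_eq_seq.
rewrite (graded_out (gb i) pX (prC p u)) raddf0 big1 // => q _; exact: if_same.
Qed.

Lemma coboundary_proj i p (u : K i) : is_coboundary u -> is_coboundary (pr i p u).
Proof.
case: i u => [|i] u /=; first by move=> ->; rewrite raddf0.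
by move=> [v ->]; exists (pr i p v); rewrite diff_proj.
Qed.

Lemma coboundary_cocycle i (u : K i) : is_coboundary u -> cdiff K i u = 0.
Proof.
have [_ dd _] := gK.
by case: i u => [|i] u /=; [move=> ->; rewrite raddf0|move=> [v ->]; apply: dd].
Qed.

Lemma cohomology_pi_eq i (z t : cycles K i) :
  ((\pi_(cohomology_group K i) z = \pi_(cohomology_group K i) t)%qT
    <-> is_coboundary (val z - val t)).
Proof.
split=> [/eqP|h]; first by rewrite -Quotient.idealrBE unfold_in raddfB => /asboolP.
by apply/eqP; rewrite -Quotient.idealrBE unfold_in raddfB; apply/asboolP.
Qed.

(** The projections commute with the differential, hence preserve cycles and coboundaries and
    descend to classes. *)
Lemma cohomology_graded i :
  exists prH, @graded_by (cohomology K i) X prH.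
Proof.
have [gb _ _] := gK; have [uX prC prE sumE] := gb i.
have prcP p (z : cycles K i) : pr i p (val z) \in @cycle_pred K i.
  by rewrite unfold_in diff_proj; have /eqP-> := valP z; rewrite raddf0.
pose prc p (z : cycles K i) : cycles K i := ZSub (prcP p z).
pose f p (h : cohomology_group K i) : cohomology_group K i :=
  (\pi_(cohomology_group K i) (prc p (repr h)))%qT.
have fE p z : (f p (\pi_(cohomology_group K i) z) =
               \pi_(cohomology_group K i) (prc p z))%qT.
  apply/cohomology_pi_eq; rewrite /= -raddfB; apply/coboundary_proj/cohomology_pi_eq.
  by rewrite reprK.
have fB p : zmod_morphism (f p).
  move=> h k; rewrite -[h]reprK -[k]reprK -raddfB !fE -raddfB.
  by congr (\pi _)%qT; apply/val_inj; rewrite /= !raddfB.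
pose fa p : {additive cohomology K i -> cohomology K i} :=
  HB.pack (f p) (GRing.isZmodMorphism.Build _ _ (f p) (fB p)).
exists fa.
split=> // [p h|p q h|h] /=.
- by rewrite unfold_in; apply/asboolP; exists (prc p (repr h)); first exact: prC.
- rewrite unfold_in => /asboolP[z zp ->]; rewrite fE.
  have -> : prc q z = if q == p then z else 0.
    by apply/val_inj; rewrite /= (prE p) //; case: eqP.
  by case: eqP; rewrite ?raddf0.
rewrite -[h]reprK; under eq_bigr => p _ do rewrite fE.
rewrite -raddf_sum; congr (\pi _)%qT; apply/val_inj.
by rewrite raddf_sum /= -sumE.
Qed.

(** [M0] is left arbitrary, with [d1] hitting exactly the coboundaries of bidegree [p], so that
    degree 0, where no term of the complex comes in, is covered as well. *)
Lemma cohomology_rank i p (M0 : zmodType) n0 n1 n2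
    (tau0 : {additive M0 -> 'rV[rat]_n0})
    (tau1 : {additive zsub (bgcomp (K i) p) -> 'rV[rat]_n1})
    (tau2 : {additive zsub (bgcomp (K i.+1) p) -> 'rV[rat]_n2})
    (d1 : {additive M0 -> zsub (bgcomp (K i) p)})
    (d2 : {additive zsub (bgcomp (K i) p) -> zsub (bgcomp (K i.+1) p)})
    (D1 : 'M_(n0, n1)) (D2 : 'M_(n1, n2)) :
  rational_chart tau0 -> rational_chart tau1 -> rational_chart tau2 ->
  (forall x, tau1 (d1 x) = tau0 x *m D1) ->
  (forall x, tau2 (d2 x) = tau1 x *m D2) ->
  (forall x, val (d2 x) = cdiff K i (val x)) ->
  (forall x : zsub (bgcomp (K i) p), is_coboundary (val x) <-> exists a, x = d1 a) ->
  (dimQ (zsub (bgcomp (cohomology K i) p)) + \rank D2 + \rank D1 = n1)%N.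
Proof.
move=> c0 c1 c2 hD1 hD2 hd2 cob; have [gb dd dh] := gK.
have repex (h : zsub (bgcomp (cohomology K i) p)) :
  exists z : cycles K i, val z \in bgcomp (K i) p /\
     val h = (\pi_(cohomology_group K i) z)%qT.
  by have := valP h; rewrite unfold_in => /asboolP[z]; exists z.
have [z /all_and2[zp zE]] := choice repex.
pose rep h : zsub (bgcomp (K i) p) := ZSub (zp h).
apply: (homology_chart (rep := rep) c0 c1 c2 hD1 hD2).
- move=> x; apply/val_inj; rewrite hd2 /=.
  by apply/coboundary_cocycle/(cob (d1 x)); exists x.
- by move=> h; apply/val_inj; rewrite hd2 /=; apply/eqP/(valP (z h)).
- move=> h k; apply/cob.
  have -> : val (rep (h - k) - (rep h - rep k)) = val (z (h - k)) - val (z h - z k).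
    by rewrite !raddfB.
  apply/cohomology_pi_eq; rewrite -zE [LHS]raddfB [RHS]raddfB.
  by congr (_ - _); apply: zE.
- move=> h a e; apply/val_inj; rewrite zE -[RHS](raddf0 (\pi_(cohomology_group K i))%qT).
  apply/cohomology_pi_eq; rewrite subr0.
  by apply: (cob (rep h)).2; exists a.
- move=> x dx; have xc : val x \in @cycle_pred K i.
    by rewrite unfold_in -hd2 dx.
  have hp : (\pi_(cohomology_group K i) (ZSub xc : cycles K i))%qT \in
       bgcomp (cohomology K i) p.
    by rewrite unfold_in; apply/asboolP; exists (ZSub xc : cycles K i) => //; apply: (valP x).
  exists (ZSub hp); apply/cob; rewrite raddfB /=.
  by apply/(cohomology_pi_eq _ (ZSub xc : cycles K i)); rewrite -zE.
Qed.

Hypothesis chartK : forall i p,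
  exists n (tau : {additive zsub (bgcomp (K i) p) -> 'rV[rat]_n}), rational_chart tau.

(** [r i] is the rank, in bidegree [p], of the differential entering [K i]. *)
Lemma cohomology_ranks p : exists r : nat -> nat, r 0 = 0%N /\
  forall i, (dimQ (zsub (bgcomp (cohomology K i) p)) + r i.+1 + r i
    = dimQ (zsub (bgcomp (K i) p)))%N.
Proof.
have [gb dd dh] := gK.
have [N chN] := choice (chartK ^~ p).
have [tau ct] := all_sig (fun i => cid (chN i)).
have [d hd] := all_sig (fun i => cid (zsub_map (@dh i p))).
have [D hD] := all_sig (fun i => cid (chart_linearization (tau i.+1) (d i) (ct i))).
exists (fun i => if i is j.+1 then \rank (D j) else 0%N); split=> // i.
rewrite (dimQ_chart (ct i)); case: i => [|i].
  (* In degree 0 the incoming term is the zero module ['rV[int]_0]. *)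
  rewrite -[X in (_ + _ + X)%N](mxrank0 rat 0 (N 0)).
  apply: (@cohomology_rank 0 p 'rV[int]_0 0 _ _ \0 (tau 0) (tau 1) \0 (d 0)) => //.
  - split=> [m _|v]; first by exists 1%N; rewrite // [m]thinmx0.
    by exists 1%N, 0; rewrite [v]thinmx0 mul0rn.
  - by move=> x; rewrite mulmx0 [tau 0 _]raddf0.
  - exact: hD.
  - move=> x /=; split=> [x0|[_ ->] //]; exists 0; exact/val_inj.
apply: (cohomology_rank (ct i) (ct i.+1) (ct i.+2)) => // x /=.
split=> [[v e]|[a ->]]; last by exists (val a); rewrite hd.
have [_ prC prE _] := gb i.
(* The preimage [v] may fail to be homogeneous, but its component of bidegree [p] has the same
   image. *)
exists (ZSub (prC p v)); apply/val_inj; rewrite hd /= diff_proj -e.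
have [_ _ prE' _] := gb i.+1.
by rewrite (prE' p) ?eqxx //; apply: (valP x).
Qed.

Lemma euler_characteristic n : (forall u : K n.+1, u = 0) ->
  \sum_(i < n.+1) (-1) ^+ i * qdim (cohomology K i) =
  \sum_(i < n.+1) (-1) ^+ i * qdim (K i).
Proof.
move=> Kn0; have [gb _ _] := gK.
have eqH i : qdim (cohomology K i) = _ := graded_qdim (projT2 (cid (cohomology_graded i))).
under eq_bigr => i _ do rewrite eqH mulr_sumr.
under [RHS]eq_bigr => i _ do rewrite (graded_qdim (gb i)) mulr_sumr.
rewrite exchange_big [RHS]exchange_big /=; apply: eq_bigr => p _.
have [r [r0 hr]] := cohomology_ranks p.
(* [K n.+1] vanishes, so the last boundary term of the telescoping sum does too. *)
have rn : r n.+1 = 0%N.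
  have := hr n.+1; rewrite [RHS]dimQ_trivial => [/eqP|u]; last exact/val_inj/Kn0.
  by rewrite !addn_eq0 => /andP[_ /eqP].
apply/eqP; rewrite eq_sym -subr_eq0 -sumrB.
have tel m : \sum_(i < m) (-1) ^+ i * ((r i.+1)%:R + (r i)%:R) = - (-1) ^+ m * (r m)%:R :> QF.
  elim: m => [|m IH]; first by rewrite big_ord0 r0 mulr0.
  by rewrite big_ord_recr /= IH exprS mulN1r opprK mulrDr mulNr addrCA addNr addr0.
rewrite (eq_bigr (fun i : 'I_n.+1 => (qx ^ p.1 * qy ^ p.2) *
   ((-1) ^+ i * ((r i.+1)%:R + (r i)%:R)))) => [|i _].
  by rewrite -mulr_sumr tel rn mulr0 mulr0.
rewrite -hr -addnA natrD (natrD _ (r _)) -mulrBr -mulrBr.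
by rewrite [X in _ * (_ * X)]addrC addKr mulrCA.
Qed.
End GradedComplex.

(** * Isomorphic complexes have isomorphic cohomology *)

(** A bijective chain map both preserves and reflects cycles and coboundaries, so the induced map on
    classes is well defined and injective; lifting cycles gives surjectivity. *)
Lemma cochain_iso_cohomology (K L : cochain) :
  cochain_isomorphic K L -> forall i, bgisomorphic (cohomology K i) (cohomology L i).
Proof.
move=> [f [fb fd]] i.
have finj j : injective (f j) by case: (fb j) => /bij_inj.
have fsurj j (v : L j) : exists u, f j u = v.
  by case: (fb j) => -[g _ gK] _; exists (g v).
have cobE j (u : K j) : is_coboundary (f j u) <-> is_coboundary u.
  case: j u => [|j] u /=; first by split=> [|->]; rewrite ?raddf0 // -(raddf0 (f 0)) => /finj.
  split=> [[v e]|[v ->]]; last by exists (f j v); rewrite fd.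
  by have [w ew] := fsurj _ v; exists w; apply: finj; rewrite e -ew fd.
have cycE (u : K i) : (f i u \in @cycle_pred L i) = (u \in @cycle_pred K i).
  rewrite !unfold_in -fd; apply/eqP/eqP => [|->]; last exact: raddf0.
  by rewrite -(raddf0 (f i.+1)) => /finj.
have fcP (z : cycles K i) : f i (val z) \in @cycle_pred L i by rewrite cycE; apply: (valP z).
pose fc (z : cycles K i) : cycles L i := ZSub (fcP z).
pose F (h : cohomology_group K i) : cohomology_group L i :=
  (\pi_(cohomology_group L i) (fc (repr h)))%qT.
have eqF z t : ((\pi_(cohomology_group L i) (fc z) = \pi_(cohomology_group L i) (fc t))%qT
      <-> (\pi_(cohomology_group K i) z = \pi_(cohomology_group K i) t)%qT).
  rewrite cohomology_pi_eq (cohomology_pi_eq z t).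
  by rewrite -cobE raddfB.
have FE z : (F (\pi_(cohomology_group K i) z) = \pi_(cohomology_group L i) (fc z))%qT.
  by apply/eqF; rewrite reprK.
have FB : zmod_morphism F.
  move=> h k; rewrite -[h]reprK -[k]reprK -raddfB !FE -raddfB.
  by congr (\pi _)%qT; apply/val_inj; rewrite /= !raddfB.
pose Fa : {additive cohomology K i -> cohomology L i} :=
  HB.pack F (GRing.isZmodMorphism.Build _ _ F FB).
have Finj : injective F.
  by move=> h k; rewrite -[h]reprK -[k]reprK !FE => /eqF.
have lift (w : cycles L i) : exists z, fc z = w.
  have [u eu] := fsurj _ (val w).
  have uc : u \in @cycle_pred K i by rewrite -cycE eu (valP w).
  by exists (ZSub uc); apply/val_inj.
exists Fa; split=> /=.
  have /choice[H FH] : forall k, exists h, F h = k.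
    move=> k; have [z ez] := lift (repr k).
    by exists (\pi_(cohomology_group K i) z)%qT; rewrite FE ez reprK.
  by exists H => // h; apply: Finj; rewrite FH.
move=> p h; rewrite !unfold_in; apply/asboolP/asboolP => -[z zp].
  have [t et] := lift z; rewrite -et -FE => /Finj ->.
  by exists t => //; rewrite -(fb i).2 -[f i _]/(val (fc t)) et.
by move=> ->; exists (fc z); rewrite ?FE //= (fb i).2.
Qed.

(** * Per-edge maps and the differential *)

Section PerEdgeMaps.
Variable G : mgraph.
Implicit Types s t w : {set edge G}.

(** Every component of [s] lies in exactly one component of [t], so the product over the components
    inside [F] can be grouped by the intermediate ones. *)
Lemma push_A_trans s t w (a : component s -> algA) : s \subset t -> t \subset w ->
  push_A (push_A a : component t -> algA) =1 push_A a :> (component w -> algA).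
Proof.
move=> st tw F.
have [p hp] := fin_all_exists (fun E : component s => comp_sub E st).
have [q hq] := fin_all_exists (fun E : component t => comp_sub E tw).
have hqp (E : component s) : (val E \subset val F) = (q (p E) == F).
  have [r hr] := comp_sub E (fintype.subset_trans st tw).
  rewrite hr; suff -> : r = q (p E) by [].
  apply/eqP; rewrite -hr.
  have h1 : val E \subset val (p E) by rewrite hp.
  have h2 : val (p E) \subset val (q (p E)) by rewrite hq.
  exact: fintype.subset_trans h1 h2.
rewrite /push_A (eq_bigl (fun E => q (p E) == F)) => [|E]; last exact: hqp.
rewrite (partition_big p (fun F' => q F' == F)) //=; apply: eq_big => [F'|F' hF'].
  exact: hq.
apply: eq_bigl => E; rewrite hp; case: eqP => [->|]; rewrite ?andbF //.
by rewrite -hq hF'.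
Qed.

(** Padding with factors 1 in two stages is padding once, as no factor of [b] is cut off on the
    way. *)
Lemma push_B_trans s t w (b : 'I_(b1 s) -> modB) : (b1 s <= b1 t)%N ->
  push_B (push_B b : 'I_(b1 t) -> modB) =1 push_B b :> ('I_(b1 w) -> modB).
Proof.
move=> st k; rewrite /push_B; case: insubP => [l _ <- //|/= kt].
by rewrite insubF //; apply: contraNF kt => /leq_trans; apply.
Qed.

Lemma dedge_trans s t w e f (u : Cs s) : e \notin s -> t = e |: s ->
  f \notin t -> w = f |: t -> dedge w (dedge t u) = dedge w u.
Proof.
move=> es -> {t} ft -> {w}; rewrite [X in dedge _ X]/dedge raddf_sum.
rewrite [RHS]/dedge; apply: eq_bigr => m _; rewrite [LHS]raddfMz.
rewrite [X in X *~ _](dedge_pure _ _ ft).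
have st : s \subset e |: s by apply: finset.subsetUr.
have tw : e |: s \subset f |: (e |: s) by apply: finset.subsetUr.
set a := fun _ => _; set b := fun _ => _; set k := u m.
have -> : push_A (push_A a : component (e |: s) -> algA) =
    push_A a :> (component (f |: (e |: s)) -> algA).
  by apply: funext => F; apply: push_A_trans.
have -> // : push_B (push_B b : 'I_(b1 (e |: s)) -> modB) =
    push_B b :> ('I_(b1 (f |: (e |: s))) -> modB).
by apply: funext => l; apply/push_B_trans/b1_setU1.
Qed.

(** Both the multiplication of [A] factors and the padding of [B] factors are products over fibers,
    which lets [fiber_degree] treat them alike. *)
Lemma push_fibers s e : e \notin s ->
  exists (p : component s -> component (e |: s))
         (q : 'I_(b1 s) -> 'I_(b1 (e |: s))),
    (forall a F, push_A a F = \prod_(E | p E == F) a E) /\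
    (forall b k, push_B b k = \prod_(l | q l == k) b l).
Proof.
move=> es; have st : s \subset e |: s by apply: finset.subsetUr.
have [p hp] := fin_all_exists (fun E : component s => comp_sub E st).
exists p, (widen_ord (b1_setU1 es)); split=> [a F|b k].
  by apply: eq_bigl => E; rewrite hp.
rewrite /push_B; case: insubP => [l _ lk|/= hk].
  rewrite (big_pred1 l) //= => l'; rewrite -val_eqE /=.
  by rewrite -[X in _ == X]lk -val_eqE.
rewrite big1 // => l /eqP lk; case/negP: hk.
by rewrite -lk /= ltn_ord.
Qed.

Lemma coef_qX (k : nat) (c : 'I_2) :
  (('qX ^+ k : algA) : {poly int})`_c != 0 -> k = c.
Proof.
have size2 : size (mk_monic ('X^2 : {poly int})) = 3.
  by rewrite mk_monic_Xn size_polyXn.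
have qX1 : (('qX : algA) : {poly int}) = 'X.
  by rewrite in_qpoly_small ?size2 ?size_polyX.
case: k => [|[|k]].
- rewrite expr0 -[_`_c]/((1%:P : {poly int})`_c) coefC.
  by case: c => [[|[|]]].
- by rewrite expr1 qX1 coefX; case: c => [[|[|]]].
have qX2 : 'qX ^+ 2 = 0 :> algA.
  rewrite /qpolyX -rmorphXn; apply/val_inj => /=.
  by rewrite mk_monic_Xn Pdiv.RingMonic.rmodpp ?monicXn.
by rewrite -[X in 'qX ^+ X]addn2 exprD qX2 mulr0 coef0 eqxx.
Qed.

(** A non-zero product has only non-zero factors, and by [coef_qX] each of them forces the exponents
    in its fiber to add up to [g j]. *)
Lemma fiber_degree (I J : finType) (p : I -> J) (f : I -> 'I_2) (g : J -> 'I_2) :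
  \prod_j ((\prod_(i | p i == j) 'qX ^+ f i : algA) : {poly int})`_(g j) != 0 ->
  (\sum_i f i = \sum_j g j)%N.
Proof.
move/prodf_neq0 => h; rewrite (partition_big p predT) //=.
apply: eq_bigr => j _; apply: coef_qX.
by rewrite expr_sum; apply: h.
Qed.

Lemma dedge_bideg s e (u : Cs s) p : e \notin s ->
  (forall m, u m != 0 -> bideg m = p) ->
  forall m, dedge (e |: s) u m != 0 -> bideg m = p.
Proof.
move=> es hu m; rewrite /dedge sum_ffunE; apply: contraNeq => mp.
apply/eqP; apply: big1 => m' _; rewrite ffunMzE.
have [->|/hu m'p] := eqVneq (u m') 0; first by rewrite mulr0z.
have [pm [q [hp hq]]] := push_fibers es.
set x := pure _ _ m; suff -> : x = 0 by rewrite mul0rz.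
rewrite {}/x; apply/eqP; move: mp; apply: contraNT.
rewrite ffunE mulf_eq0 negb_or => /andP[hA hB].
rewrite -m'p /bideg; apply/eqP; congr (_%:Z, _%:Z).
  apply/esym/(fiber_degree (p := pm)); move: hA.
  by congr (_ != _); apply: eq_bigr => F _; rewrite hp.
apply/esym/(fiber_degree (p := q)); move: hB.
by congr (_ != _); apply: eq_bigr => F _; rewrite hq.
Qed.

(** * Edge signs and the vanishing of the squared differential *)

Section Ordering.
Variable o : 'I_#|edge G| -> edge G.

Lemma edge_signE r s j : cancel o r -> cancel r o ->
  edge_sign o s j = \prod_(e in s) (-1) ^+ (r e < j)%N.
Proof.
move=> or ro; rewrite /edge_sign -expr_sum; congr (_ ^+ _).
rewrite -sum1_card big_mkcond /= (reindex o) /=; last by exists r => x _.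
rewrite [RHS]big_mkcond /=; apply: eq_bigr => k _.
by rewrite inE or andbC; case: (o k \in s).
Qed.

Lemma edge_sign_setU1 s (j k : 'I_#|edge G|) : bijective o -> o j \notin s ->
  edge_sign o (o j |: s) k = (-1) ^+ (j < k)%N * edge_sign o s k.
Proof.
by move=> [r or ro] js; rewrite !(edge_signE _ _ or ro) big_setU1 //= or.
Qed.

Hypothesis ho : bijective o.

Lemma tutte_diff_diff i (u : Ci G i) : tutte_diff o (tutte_diff o u) = 0.
Proof.
apply/ffunP=> t; rewrite [LHS]ffunE [RHS]ffunE.
pose c' (t' : sets_of_size G i.+1) j' := (o j' \notin val t') && (o j' |: val t' == val t).
pose c (s : sets_of_size G i) j (t' : sets_of_size G i.+1) :=
  (o j \notin val s) && (o j |: val s == val t').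
(* All two-step paths from [s] to [t] carry the same map, so only the sum [S s] of their signs has
   to vanish. *)
pose S (s : sets_of_size G i) : int := \sum_t' \sum_j' \sum_j
  if c' t' j' && c s j t' then edge_sign o (val s) j * edge_sign o (val t') j' else 0.
transitivity (\sum_(s : sets_of_size G i) dedge (val t) (u s) *~ S s).
  transitivity (\sum_t' \sum_(j' | c' t' j') \sum_s \sum_(j | c s j t')
     dedge (val t) (u s) *~ (edge_sign o (val s) j * edge_sign o (val t') j')).
    apply: eq_bigr => t' _; apply: eq_bigr => j' /andP[j't' /eqP et].
    rewrite ffunE [dedge _ _]raddf_sum mulrz_suml; apply: eq_bigr => s _.
    rewrite [X in X *~ _]raddf_sum mulrz_suml; apply: eq_bigr => j /andP[js /eqP et'].
    rewrite [X in X *~ _]raddfMz -mulrzA.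
    by rewrite [X in X *~ _](dedge_trans _ js (esym et') j't' (esym et)).
  (* Side conditions become zero coefficients, which makes the index ranges independent and the sums
     exchangeable. *)
  transitivity (\sum_t' \sum_j' \sum_s \sum_j
     dedge (val t) (u s) *~
       if c' t' j' && c s j t' then edge_sign o (val s) j * edge_sign o (val t') j' else 0).
    apply: eq_bigr => t' _; rewrite big_mkcond; apply: eq_bigr => j' _.
    case: (c' t' j').
      apply: eq_bigr => s _; rewrite big_mkcond; apply: eq_bigr => j _ /=.
      by case: ifP; rewrite ?mulr0z.
    by rewrite big1 // => s _; rewrite big1 // => j _; rewrite mulr0z.
  under eq_bigr => t' _ do rewrite exchange_big.
  rewrite exchange_big; apply: eq_bigr => s _; rewrite mulrz_sumr.
  by apply: eq_bigr => t' _; rewrite mulrz_sumr; apply: eq_bigr => j' _; rewrite mulrz_sumr.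
apply: big1 => s _; suff -> : S s = 0 by rewrite mulr0z.
pose cond j j' := [&& o j \notin val s, o j' \notin o j |: val s
  & o j' |: (o j |: val s) == val t].
pose g (j j' : 'I_#|edge G|) :=
  edge_sign o (val s) j * ((-1) ^+ (j < j')%N * edge_sign o (val s) j').
have -> : S s = \sum_j \sum_j' if cond j j' then g j j' else 0.
  rewrite /S exchange_big [RHS]exchange_big; apply: eq_bigr => j' _.
  rewrite exchange_big; apply: eq_bigr => j _.
  have [js|js] := boolP (o j \in val s).
    by rewrite /cond js big1 // => t' _; rewrite /c js andbF.
  have sz : #|o j |: val s| == i.+1 by rewrite cardsU1 js (eqP (valP s)).
  (* The intermediate set is determined by [s] and [j]. *)
  pose t0 : sets_of_size G i.+1 := exist (fun A : {set edge G} => #|A| == i.+1) _ sz.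
  rewrite (bigD1 t0) //= big1 ?addr0 => [|t' t'0]; last first.
    rewrite /c js /= ifN // negb_and orbC; apply/orP; left; apply: contraNN t'0 => /eqP h.
    by apply/eqP/val_inj.
  by rewrite /c' /c /cond js /= eqxx andbT /g edge_sign_setU1.
(* Swapping [j] and [j'] keeps [cond], which forces [j != j']. Exactly one of [j < j'] and [j' < j]
   holds, so the swap negates every term. *)
set T := LHS; have TN : T = - T.
  rewrite {1}/T exchange_big /= /T -sumrN; apply: eq_bigr => j _.
  rewrite -sumrN; apply: eq_bigr => j' _.
  have -> : cond j' j = cond j j'.
    rewrite /cond finset.setUCA !in_setU1 !negb_or !(inj_eq (bij_inj ho)) [j == j']eq_sym.
    by case: (o j \in _); case: (o j' \in _); rewrite ?andbF.
  case: ifP; rewrite ?oppr0 // => /and3P[_ + _].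
  rewrite in_setU1 (inj_eq (bij_inj ho)) negb_or -val_eqE /= => /andP[jj' _].
  rewrite /g; move: (edge_sign _ _ j) (edge_sign _ _ j') jj' => x y.
  by case: ltngtP => // _ _; rewrite expr0 expr1; ring.
have : T *+ 2 == 0 by rewrite mulr2n {2}TN subrr.
by rewrite mulrn_eq0 => /eqP.
Qed.

Lemma tutte_diff_comp i p (u : Ci G i) : u \in @Ci_comp_pred G i p ->
  tutte_diff o u \in @Ci_comp_pred G i.+1 p.
Proof.
move=> /forallP hu; apply/forallP=> t; apply/forallP=> m; apply/implyP => h.
apply/eqP; move: h; apply: contraNeq => mp; rewrite ffunE sum_ffunE.
apply/eqP; apply: big1 => s _; rewrite sum_ffunE; apply: big1 => j /andP[js /eqP e].
rewrite ffunMzE; suff -> : dedge (val t) (u s) m = 0 by rewrite mul0rz.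
apply/eqP; move: mp; apply: contraNT; move: m; rewrite -e => m hm; apply/eqP.
apply: dedge_bideg hm => // m' um'; apply/eqP.
by have /forallP/(_ m')/implyP := hu s; apply.
Qed.
End Ordering.
End PerEdgeMaps.

(** * Bidegrees and graded dimensions of the Tutte complex *)

(** The coordinates identify [M] with a free group on [T]; a rational vector becomes integral after
    multiplication by the product of its denominators. *)
Lemma coordinate_chart (M : zmodType) (T : finType) (phi : M -> T -> int) :
  (forall x u v, phi (u - v) x = phi u x - phi v x) ->
  (forall u, (forall x, phi u x = 0) -> u = 0) ->
  (forall g : T -> int, exists u, forall x, phi u x = g x) ->
  exists tau : {additive M -> 'rV[rat]_#|T|}, rational_chart tau.
Proof.
move=> phiB phi0 phiS.
pose f u : 'rV[rat]_#|T| := \row_k (phi u (enum_val k))%:~R.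
have fB : zmod_morphism f.
  by move=> u v; apply/rowP=> k; rewrite !mxE phiB intrB.
pose fa : {additive M -> 'rV[rat]_#|T|} :=
  HB.pack f (GRing.isZmodMorphism.Build _ _ f fB).
exists fa; split=> [u fu|v] /=.
  exists 1%N => //; apply: phi0 => x; apply/eqP.
  have /rowP/(_ (enum_rank x))/eqP := fu.
  by rewrite !mxE enum_rankK intr_eq0.
pose k := (\prod_j `|denq (v 0%R j)|)%N.
have kv j : exists z : int, v 0 j *+ k = z%:~R.
  rewrite /k (bigD1 j) //=; set l := (\prod_(i | _) _)%N.
  exists (numq (v 0 j) *+ l).
  rewrite mulrnA -[X in _ = X *~ _]/(1%:R) rmorphMn /=; congr (_ *+ _).
  by rewrite numqE -mulr_natr pmulrn gez0_abs ?denq_ge0.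
have [z zE] := choice kv.
have [u uE] := phiS (fun x => z (enum_rank x)).
exists k, u; split; first by rewrite prodn_gt0 // => j; rewrite absz_gt0 denq_neq0.
apply/rowP=> j; rewrite mxE uE enum_valK -zE.
by rewrite -mulr_natl -scaler_nat mxE.
Qed.

Section Grading.
Variable G : mgraph.

Definition graph_bidegs : seq (int * int) :=
  undup (flatten [seq [seq bideg m | m : monomial s] | s : {set edge G}]).

Lemma mem_graph_bidegs (s : {set edge G}) (m : monomial s) : bideg m \in graph_bidegs.
Proof.
rewrite mem_undup; apply/flattenP; exists [seq bideg m | m : monomial s].
  by apply/mapP; exists s; rewrite ?mem_enum.
by apply/mapP; exists m; rewrite ?mem_enum.
Qed.

Lemma Ci_addE i (u v : Ci G i) s m : (u + v) s m = u s m + v s m.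
Proof. by rewrite !ffunE. Qed.

Definition Ci_proj i (p : int * int) (u : Ci G i) : Ci G i :=
  finfun (fun s : sets_of_size G i =>
    [ffun m : monomial (val s) => if bideg m == p then u s m else 0] : Cs (val s)).

Lemma Ci_proj_additive i p : zmod_morphism (@Ci_proj i p).
Proof.
move=> u v; apply/ffunP=> s; apply/ffunP=> m; rewrite !ffunE.
by case: ifP; rewrite ?subr0.
Qed.
HB.instance Definition _ i p :=
  GRing.isZmodMorphism.Build (Ci G i) (Ci G i) (@Ci_proj i p) (@Ci_proj_additive i p).

Variable o : 'I_#|edge G| -> edge G.
Hypothesis ho : bijective o.

Lemma tutte_graded :
  @graded_complex (tutte_complex o) graph_bidegs (fun i p => @Ci_proj i p).
Proof.
split=> [i|i u|i p u]; last 2 first.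
- exact: tutte_diff_diff.
- exact: tutte_diff_comp.
split; first exact: undup_uniq.
- move=> p u; apply/forallP=> s; apply/forallP=> m; rewrite !ffunE.
  by case: ifP; rewrite ?eqxx ?implybT.
- move=> p q u /forallP hu; apply/ffunP=> s; apply/ffunP=> m; rewrite !ffunE.
  have /forallP/(_ m)/implyP := hu s; case: (eqVneq (u s m) 0) => [e _|_ /(_ isT)/eqP->].
    by case: (q == p); case: ifP; rewrite ?e // !ffunE.
  by rewrite eq_sym; case: (q == p) => //; rewrite !ffunE.
move=> u; apply/ffunP=> s; apply/ffunP=> m.
have sumE r : (\sum_(p <- r) Ci_proj p u : Ci G i) s m = \sum_(p <- r) Ci_proj p u s m.
  elim: r => [|p r IH]; first by rewrite !big_nil !ffunE.
  by rewrite !big_cons -IH Ci_addE.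
rewrite sumE.
under eq_bigr => p _ do rewrite !ffunE eq_sym.
by rewrite sum_if_eq_seq ?undup_uniq ?mem_graph_bidegs.
Qed.

Definition summand_basis i (s : sets_of_size G i) : finType := monomial (val s).

Definition basis_index i p :=
  {x : {s : sets_of_size G i & summand_basis s} | bideg (tagged x) == p}.

Lemma Ci_comp_chart i p : exists tau :
    {additive zsub (@Ci_comp_pred G i p) -> 'rV[rat]_#|{: basis_index i p}|},
  rational_chart tau.
Proof.
pose phi (u : zsub (@Ci_comp_pred G i p)) (x : basis_index i p) : int :=
  val u (tag (val x)) (tagged (val x)).
apply: (@coordinate_chart _ _ phi); rewrite /phi.
- by move=> x u v; rewrite raddfB !ffunE.
- move=> u u0; apply/val_inj/ffunP=> s; apply/ffunP=> m.
  have -> : val (0 : zsub (@Ci_comp_pred G i p)) s m = 0 by rewrite raddf0 !ffunE.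
  have /forallP/(_ s)/forallP/(_ m)/implyP h := valP u.
  have [//|/h mp] := eqVneq (val u s m) 0.
  pose x : basis_index i p := exist (fun x : {s & summand_basis s} => bideg (tagged x) == p)
    (existT (@summand_basis i) s m) mp.
  by have := u0 x.
move=> g; pose v : Ci G i := finfun (fun s : sets_of_size G i => [ffun m : monomial (val s) =>
   oapp g 0 (insub (Tagged (@summand_basis i) m))] : Cs (val s)).
have vP : v \in @Ci_comp_pred G i p.
  apply/forallP=> s; apply/forallP=> m; rewrite !ffunE.
  by case: insubP => [x hx _|]; rewrite ?eqxx //= hx implybT.
exists (ZSub vP) => x; rewrite /= !ffunE.
by case: x => -[s m] hx; rewrite /= insubT.
Qed.

Lemma qdim_Ci i : qdim (tutte_complex o i) =
  \sum_(s : sets_of_size G i) (1 + qx) ^+ b0 (val s) * (1 + qy) ^+ b1 (val s).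
Proof.
have [gb _ _] := tutte_graded; rewrite (graded_qdim (gb i)).
have sum2 (x : QF) : \sum_(c < 2) x ^+ c = 1 + x.
  by rewrite big_ord_recl big_ord1 expr0 expr1.
transitivity (\sum_(s : sets_of_size G i) \sum_(m : monomial (val s))
   qx ^ (bideg m).1 * qy ^ (bideg m).2).
  rewrite (@sig_big_dep _ _ _ _ _ (fun _ => true) (fun _ _ => true)
    (fun s (m : monomial (val s)) => qx ^ (bideg m).1 * qy ^ (bideg m).2)) /=.
  (* The dimension in bidegree [p] counts the basis elements of that bidegree, so summing over [p]
     meets each basis element once. *)
  transitivity (\sum_(p <- graph_bidegs)
     \sum_(x : {s : sets_of_size G i & summand_basis s})
       if p == bideg (tagged x)
       then qx ^ (bideg (tagged x)).1 * qy ^ (bideg (tagged x)).2 else 0).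
    apply: eq_bigr => p _; have [tau ct] := Ci_comp_chart i p.
    rewrite (dimQ_chart ct) card_sig -sum1_card natr_sum mulr_sumr.
    rewrite -big_mkcond; apply: eq_big => [x|x].
      by rewrite eq_sym.
    by rewrite unfold_in => /eqP ->; rewrite mulr1.
  rewrite exchange_big; apply: eq_bigr => x _.
  by rewrite sum_if_eq_seq ?undup_uniq ?mem_graph_bidegs.
apply: eq_bigr => s _; rewrite -!sum2.
have -> : b0 (val s) = #|{: component (val s)}| by rewrite card_sig.
(* Each power is a product of sums over [c < 2]; distributing chooses an exponent for every tensor
   factor, that is, a monomial. *)
rewrite -[b1 (val s) in RHS]card_ord -!prodr_const !bigA_distr_bigA big_distrlr pair_bigA /=.
by apply: eq_bigr => m _; rewrite -!expr_sum.
Qed.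

Lemma tutte_polynomial :
  \sum_(i < #|edge G|.+1) (-1) ^+ i * qdim (tutte_complex o i) = That G qx qy.
Proof.
have hs (s : {set edge G}) : (#|s| < #|edge G|.+1)%N by rewrite ltnS max_card.
rewrite /That (partition_big (fun s => Ordinal (hs s)) predT) //=.
apply: eq_bigr => i _; rewrite qdim_Ci mulr_sumr.
rewrite [RHS](reindex_omap (val : sets_of_size G i -> _) insub) => [|s]; last first.
  by rewrite -val_eqE /= => hi; rewrite insubT.
apply: eq_big => [s|s _].
  by rewrite valK -val_eqE /= (valP s) eqxx.
by rewrite (eqP (valP s)) mulrA.
Qed.
End Grading.

(** * Transport along a graph isomorphism *)

(** Explicit inverses make the notion symmetric, so each transport lemma also applies backwards once
    its section is closed. *)
Definition graph_iso_pair (G G' : mgraph) (fV : vertex G -> vertex G')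
    (gV : vertex G' -> vertex G) (fE : edge G -> edge G') (gE : edge G' -> edge G) :
    Prop :=
  [/\ cancel fV gV, cancel gV fV, cancel fE gE, cancel gE fE
    & forall e, ends (fE e) = [set fV v | v in ends e]].

Lemma imsetK (S T : finType) (f : S -> T) g (A : {set S}) :
  cancel f g -> g @: (f @: A) = A.
Proof. by move=> fK; rewrite -imset_comp (eq_imset _ fK) imset_id. Qed.

Lemma graph_iso_pair_sym G G' fV gV fE gE :
  @graph_iso_pair G G' fV gV fE gE -> @graph_iso_pair G' G gV fV gE fE.
Proof.
move=> [fVK gVK fEK gEK fends]; split=> // e.
by rewrite -{2}[e]gEK fends imsetK.
Qed.

Section Relabelling.
Variables (G G' : mgraph) (fV : vertex G -> vertex G') (gV : vertex G' -> vertex G).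
Variables (fE : edge G -> edge G') (gE : edge G' -> edge G).
Hypothesis iso : graph_iso_pair fV gV fE gE.

Lemma connect_relabel (s : {set edge G}) x y :
  connect (adj s) x y -> connect (adj (fE @: s)) (fV x) (fV y).
Proof.
have [_ _ _ _ fends] := iso.
move=> /connectP[p + ->]; elim: p x => [|z p IH] x /=; first by rewrite connect0.
move=> /andP[/existsP[e /andP[es /eqP he]] /IH]; apply: connect_trans.
apply: connect1; apply/existsP; exists (fE e).
by rewrite imset_f //= fends he imsetU1 imset_set1.
Qed.
End Relabelling.

Section RelabelComponents.
Variables (G G' : mgraph) (fV : vertex G -> vertex G') (gV : vertex G' -> vertex G).
Variables (fE : edge G -> edge G') (gE : edge G' -> edge G).
Hypothesis iso : graph_iso_pair fV gV fE gE.

Lemma relabel_component (s : {set edge G}) s' (E : component s) : s' = fE @: s ->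
  fV @: val E \in components s'.
Proof.
move=> ->; have [fVK gVK fEK gEK _] := iso.
have [x ->] := (mem_components s (val E)).1 (valP E).
apply/mem_components; exists (fV x); apply/setP=> y; rewrite inE.
rewrite -[y]gVK mem_imset ?inE; last exact: can_inj fVK.
apply/idP/idP => [|h]; first exact: (connect_relabel iso).
have := connect_relabel (graph_iso_pair_sym iso) h.
by rewrite !fVK imsetK.
Qed.
End RelabelComponents.

Section RelabelModules.
Variables (G G' : mgraph) (fV : vertex G -> vertex G') (gV : vertex G' -> vertex G).
Variables (fE : edge G -> edge G') (gE : edge G' -> edge G).
Hypothesis iso : graph_iso_pair fV gV fE gE.

Lemma component_bij (s : {set edge G}) s' : s' = fE @: s ->
  exists phi : component s -> component s',
    bijective phi /\ forall E, val (phi E) = fV @: val E.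
Proof.
move=> es'; have [fVK gVK fEK gEK _] := iso.
have es : s = gE @: s' by rewrite es' imsetK.
pose phi (E : component s) : component s' := exist (fun E => E \in components s') _
  (relabel_component iso E es').
pose psi (E : component s') : component s := exist (fun E => E \in components s) _
  (relabel_component (graph_iso_pair_sym iso) E es).
by exists phi; split=> //; exists psi => E; apply/val_inj; rewrite /= imsetK.
Qed.

Lemma b1_relabel (s : {set edge G}) s' : s' = fE @: s -> b1 s = b1 s'.
Proof.
move=> es'; have [fVK gVK fEK gEK _] := iso.
have [phi [bphi _]] := component_bij es'.
have := bij_eq_card bphi; rewrite !card_sig => b0E.
rewrite /b1 /b0 (_ : #|components s| = #|components s'|) //.
by rewrite es' card_imset ?(bij_eq_card (Bijective fVK gVK)) //; apply: can_inj fEK.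
Qed.

Lemma cycle_bij (s : {set edge G}) s' : s' = fE @: s ->
  exists psi : 'I_(b1 s) -> 'I_(b1 s'), bijective psi /\ forall k, val (psi k) = val k.
Proof.
move/b1_relabel=> e; exists (cast_ord e); split=> //.
exact: Bijective (cast_ordK e) (cast_ordKV e).
Qed.
End RelabelModules.

(* Both options are never [None] when [s'] is the image of [s]; this total
   definition avoids transporting along equalities of edge sets. *)
Definition pull_monomial (G G' : mgraph) (fV : vertex G -> vertex G')
    (s : {set edge G}) (s' : {set edge G'}) (m : monomial s') : monomial s :=
  ([ffun E : component s => oapp m.1 ord0 (insub (fV @: val E))],
   [ffun k : 'I_(b1 s) => oapp m.2 ord0 (insub (val k))]).

Definition relabel (G G' : mgraph) (fV : vertex G -> vertex G')
    (s : {set edge G}) (s' : {set edge G'}) (u : Cs s) : Cs s' :=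
  [ffun m : monomial s' => u (pull_monomial fV s m)].

Lemma relabel_additive G G' fV s s' : zmod_morphism (@relabel G G' fV s s').
Proof. by move=> u v; apply/ffunP=> m; rewrite !ffunE. Qed.
HB.instance Definition _ G G' fV s s' :=
  GRing.isZmodMorphism.Build (Cs s) (Cs s') (@relabel G G' fV s s')
    (@relabel_additive G G' fV s s').

Section RelabelMaps.
Variables (G G' : mgraph) (fV : vertex G -> vertex G') (gV : vertex G' -> vertex G).
Variables (fE : edge G -> edge G') (gE : edge G' -> edge G).
Hypothesis iso : graph_iso_pair fV gV fE gE.

Lemma pull_monomialE (s : {set edge G}) (s' : {set edge G'}) (m : monomial s') :
  (forall (E : component s) (E' : component s'), val E' = fV @: val E ->
     (pull_monomial fV s m).1 E = m.1 E') /\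
  (forall (k : 'I_(b1 s)) (k' : 'I_(b1 s')), val k' = val k ->
     (pull_monomial fV s m).2 k = m.2 k').
Proof. by split=> [E E' e|k k' e]; rewrite ffunE -e valK. Qed.

Lemma pull_bideg (s : {set edge G}) s' (m : monomial s') : s' = fE @: s ->
  bideg (pull_monomial fV s m) = bideg m.
Proof.
move=> es'; have [phi [bphi phiE]] := component_bij iso es'.
have [psi [bpsi psiE]] := cycle_bij iso es'.
have [h1 h2] := pull_monomialE s m.
rewrite /bideg; congr (_%:Z, _%:Z).
  rewrite [RHS](reindex phi) /=; last exact: onW_bij.
  by apply: eq_bigr => E _; rewrite (h1 _ (phi E)).
rewrite [RHS](reindex psi) /=; last exact: onW_bij.
by apply: eq_bigr => E _; rewrite (h2 _ (psi E)).
Qed.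

Lemma pull_monomialK (s : {set edge G}) (s' : {set edge G'}) (m : monomial s) :
  s' = fE @: s -> pull_monomial fV s (pull_monomial gV s' m) = m.
Proof.
move=> es'; have [fVK gVK fEK gEK _] := iso.
have [phi [bphi phiE]] := component_bij iso es'.
have [psi [bpsi psiE]] := cycle_bij iso es'.
have [h1 h2] := pull_monomialE s (pull_monomial gV s' m).
rewrite [LHS]surjective_pairing [RHS]surjective_pairing; congr (_, _).
  apply/ffunP=> E; rewrite (h1 _ (phi E)) //.
  by rewrite ffunE phiE imsetK // valK.
apply/ffunP=> k; rewrite (h2 _ (psi k)) //.
by rewrite ffunE psiE valK.
Qed.
End RelabelMaps.

Section RelabelDiff.
Variables (G G' : mgraph) (fV : vertex G -> vertex G') (gV : vertex G' -> vertex G).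
Variables (fE : edge G -> edge G') (gE : edge G' -> edge G).
Hypothesis iso : graph_iso_pair fV gV fE gE.

(** [dedge] depends only on inclusions between components and on the indices of the [B] factors; the
    bijections [phi] and [psi], and their analogues for [t], preserve both. *)
Lemma relabel_dedge (s t : {set edge G}) s' t' (u : Cs s) :
  s' = fE @: s -> t' = fE @: t ->
  dedge t' (relabel fV s' u) = relabel fV t' (dedge t u).
Proof.
move=> es' et'; have [fVK gVK fEK gEK _] := iso.
have [phi [bphi phiE]] := component_bij iso es'.
have [psi [bpsi psiE]] := cycle_bij iso es'.
have [phit [bphit phitE]] := component_bij iso et'.
have [psit [bpsit psitE]] := cycle_bij iso et'.
have es : s = gE @: s' by rewrite es' imsetK.
apply/ffunP=> m; rewrite [RHS]ffunE /dedge !sum_ffunE.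
rewrite [RHS](reindex (fun m1 : monomial s' => pull_monomial fV s m1)) /=; last first.
  apply: onW_bij; exists (fun m1 : monomial s => pull_monomial gV s' m1) => m1.
    exact: (pull_monomialK (graph_iso_pair_sym iso)).
  exact: (pull_monomialK iso).
apply: eq_bigr => m1 _; rewrite [LHS]ffunMzE [RHS]ffunMzE.
rewrite [in LHS]/relabel [in X in _ *~ X]ffunE.
congr (_ *~ _); rewrite [LHS]ffunE [RHS]ffunE.
have [h1 h2] := pull_monomialE fV s m1.
have [k1 k2] := pull_monomialE fV t m.
congr (_ * _).
  rewrite [LHS](reindex phit) /=; last exact: onW_bij.
  apply: eq_bigr => F _; rewrite (k1 _ (phit F)) //.
  congr (_`_ _); congr (polyseq _); congr polyn.
  rewrite /push_A [LHS](reindex phi) /=; last exact: onW_bij.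
  apply: eq_big => [E|E _]; last by rewrite (h1 _ (phi E)).
  rewrite phiE phitE; apply/idP/idP => h; last exact: imsetS.
  by rewrite -(imsetK (val E) fVK) -(imsetK (val F) fVK) imsetS.
rewrite [LHS](reindex psit) /=; last exact: onW_bij.
apply: eq_bigr => F _; rewrite (k2 _ (psit F)) //.
rewrite /push_B psitE.
case: insubP => [l _ el|nl]; case: insubP => [l' _ el'|nl'] //=.
- by rewrite (h2 _ l) // el.
- by case/negP: nl'; rewrite (b1_relabel iso es') -el ltn_ord.
- by case/negP: nl; rewrite -(b1_relabel iso es') -el' ltn_ord.
Qed.
End RelabelDiff.

(* The sum has a single term, see [relabel_chainE]. *)
Definition relabel_chain (G G' : mgraph) (fV : vertex G -> vertex G')
    (fE : edge G -> edge G') (eta : {set edge G'} -> int) i (u : Ci G i) : Ci G' i :=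
  finfun (fun s' : sets_of_size G' i =>
    \sum_(s : sets_of_size G i | fE @: val s == val s')
      relabel fV (val s') (u s) *~ eta (val s')).

Lemma relabel_chain_additive G G' fV fE eta i :
  zmod_morphism (@relabel_chain G G' fV fE eta i).
Proof.
move=> u v; apply/ffunP=> s'; rewrite !ffunE -sumrB.
by apply: eq_bigr => s _; rewrite !ffunE -mulrzBl raddfB.
Qed.
HB.instance Definition _ G G' fV fE eta i :=
  GRing.isZmodMorphism.Build (Ci G i) (Ci G' i) (@relabel_chain G G' fV fE eta i)
    (@relabel_chain_additive G G' fV fE eta i).

Section RelabelChains.
Variables (G G' : mgraph) (fV : vertex G -> vertex G') (gV : vertex G' -> vertex G).
Variables (fE : edge G -> edge G') (gE : edge G' -> edge G).
Hypothesis iso : graph_iso_pair fV gV fE gE.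

Lemma image_of_size i (s : sets_of_size G i) :
  exists s' : sets_of_size G' i, val s' = fE @: val s.
Proof.
have [_ _ fEK _ _] := iso.
have h : #|fE @: val s| == i by rewrite card_imset ?(valP s) //; apply: can_inj fEK.
by exists (exist (fun s : {set edge G'} => #|s| == i) _ h).
Qed.

Lemma relabel_chainE eta i (u : Ci G i) (s : sets_of_size G i) (s' : sets_of_size G' i) :
  val s' = fE @: val s ->
  relabel_chain fV fE eta u s' = relabel fV (val s') (u s) *~ eta (val s').
Proof.
move=> es; have [_ _ fEK _ _] := iso.
rewrite ffunE (big_pred1 s) // => t; rewrite es.
by rewrite (inj_eq (imset_inj (can_inj fEK))) val_eqE.
Qed.
End RelabelChains.

Section RelabelComplex.
Variables (G G' : mgraph) (fV : vertex G -> vertex G') (gV : vertex G' -> vertex G).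
Variables (fE : edge G -> edge G') (gE : edge G' -> edge G).
Hypothesis iso : graph_iso_pair fV gV fE gE.

Lemma relabel_chainK eta eta' i (u : Ci G i) :
  (forall s : {set edge G}, eta (fE @: s) * eta' s = 1) ->
  relabel_chain gV gE eta' (relabel_chain fV fE eta u) = u.
Proof.
move=> he; have [_ _ fEK _ _] := iso; apply/ffunP=> s.
have [s' es'] := image_of_size iso s.
have es : val s = gE @: val s' by rewrite es' imsetK.
rewrite (relabel_chainE (graph_iso_pair_sym iso) _ _ es) (relabel_chainE iso _ _ es').
rewrite [X in X *~ _]raddfMz -mulrzA es' he mulr1z; apply/ffunP=> m.
rewrite !ffunE; congr (u s _).
exact: (pull_monomialK iso).
Qed.

Lemma relabel_chain_comp eta i p (u : Ci G i) : u \in @Ci_comp_pred G i p ->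
  relabel_chain fV fE eta u \in @Ci_comp_pred G' i p.
Proof.
move=> /forallP hu; have [_ _ _ gEK _] := iso; apply/forallP=> s'; apply/forallP=> m.
have [s es] := image_of_size (graph_iso_pair_sym iso) s'.
have es' : val s' = fE @: val s by rewrite es imsetK.
have /forallP/(_ (pull_monomial fV (val s) m)) := hu s.
rewrite (pull_bideg iso) // (relabel_chainE iso _ _ es') ffunMzE ffunE.
apply: contraTT; rewrite !negb_imply => /andP[+ ->]; rewrite andbT.
by apply: contraNN => /eqP->; rewrite mul0rz.
Qed.

Variables (o : 'I_#|edge G| -> edge G) (o' : 'I_#|edge G'| -> edge G').

Lemma relabel_chain_diff eta i (u : Ci G i) : bijective o -> bijective o' ->
  (forall (s : {set edge G}) j j', o j \notin s -> o' j' = fE (o j) ->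
     edge_sign o s j * eta (fE @: (o j |: s)) =
     eta (fE @: s) * edge_sign o' (fE @: s) j') ->
  relabel_chain fV fE eta (tutte_diff o u) = tutte_diff o' (relabel_chain fV fE eta u).
Proof.
move=> [r or ro] [r' or' ro'] hsign; have [_ _ fEK gEK _] := iso.
apply/ffunP=> t'.
have [t et] := image_of_size (graph_iso_pair_sym iso) t'.
have et' : val t' = fE @: val t by rewrite et imsetK.
rewrite (relabel_chainE iso _ _ et') [in LHS]ffunE [RHS]ffunE.
have [sg hsg] := fin_all_exists (@image_of_size _ _ _ _ _ _ iso i).
have [sg' hsg'] := fin_all_exists (@image_of_size _ _ _ _ _ _ (graph_iso_pair_sym iso) i).
rewrite [RHS](reindex sg) /=; last first.
  apply: onW_bij; exists sg' => s; apply/val_inj.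
    by rewrite (hsg' (sg s)) (hsg s) imsetK.
  by rewrite (hsg (sg' s)) (hsg' s) imsetK.
rewrite [X in X *~ _]raddf_sum mulrz_suml; apply: eq_bigr => s _.
rewrite [X in X *~ _]raddf_sum mulrz_suml.
(* The position in [o'] of the image of the [j]-th edge. *)
rewrite [RHS](reindex (fun j => r' (fE (o j)))) /=; last first.
  by apply: onW_bij; exists (fun j' => r (gE (o' j'))) => j;
    rewrite ?ro' ?fEK ?or ?ro ?gEK ?or'.
apply: eq_big => [j|j /andP[js /eqP ejs]].
  rewrite ro' hsg et' -imsetU1 (inj_eq (imset_inj (can_inj fEK))).
  by rewrite (mem_imset _ _ (can_inj fEK)).
rewrite [X in X *~ _]raddfMz (relabel_chainE iso _ _ (hsg s)).
rewrite [in RHS]raddfMz /= (relabel_dedge iso _ (hsg s) et') -!mulrzA; congr (_ *~ _).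
have ejs' : val t = o j |: val s by [].
by rewrite hsg et' ejs'; apply: hsign; rewrite ?ro'.
Qed.

(* The sign of the permutation comparing the two orderings of the edges in [s]. *)
Definition reorder_sign (r r' : edge G -> nat) (s : {set edge G}) : int :=
  \prod_(e in s) \prod_(f in s) (-1) ^+ ((r e < r f)%N && (r' f < r' e)%N).

(** The new inversions pair [e] with some [f] in [s]. Such a pair is inverted exactly when the
    comparisons of [f] with [e] under [r] and [r'] disagree, so multiplying by the sign of the first
    comparison gives that of the second. *)
Lemma reorder_sign_setU1 (r r' : edge G -> nat) (s : {set edge G}) e :
  injective r -> injective r' -> e \notin s ->
  (\prod_(f in s) (-1) ^+ (r f < r e)%N) * reorder_sign r r' (e |: s) =
  reorder_sign r r' s * \prod_(f in s) (-1) ^+ (r' f < r' e)%N.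
Proof.
move=> ri ri' es; rewrite /reorder_sign big_setU1 //= big_setU1 //= ltnn mul1r.
under [X in _ * (_ * X)]eq_bigr => f _ do rewrite big_setU1 //=.
rewrite big_split /= !mulrA [RHS]mulrC; congr (_ * _).
rewrite -!big_split /=; apply: eq_bigr => f fs.
have ef : f != e by apply: contraNneq es => <-.
have h1 : r f != r e by rewrite (inj_eq ri).
have h2 : r' f != r' e by rewrite (inj_eq ri').
by case: (ltngtP (r f) (r e)) h1; case: (ltngtP (r' f) (r' e)) h2.
Qed.

Lemma reorder_sign_sqr (r r' : edge G -> nat) (s : {set edge G}) :
  reorder_sign r r' s * reorder_sign r r' s = 1.
Proof.
rewrite /reorder_sign -big_split big1 // => e _; rewrite -big_split big1 // => f _.
by case: (_ && _).
Qed.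
End RelabelComplex.

Lemma graph_iso_cochain (G G' : mgraph) o o' : graph_iso G G' ->
  bijective o -> bijective o' ->
  cochain_isomorphic (@tutte_complex G o) (@tutte_complex G' o').
Proof.
move=> [fV [fE [[gV fVK gVK] [gE fEK gEK] fends]]] [r or ro] [r' or' ro'].
have iso : graph_iso_pair fV gV fE gE by [].
(* The ordering of [G] is compared with the one pulled back from [G'] along [fE]. *)
pose eps := reorder_sign (fun e => r e) (fun e => r' (fE e)).
pose eta (s' : {set edge G'}) := eps (gE @: s').
exists (fun i => @relabel_chain G G' fV fE eta i); split=> [i|i u]; last first.
  apply: (relabel_chain_diff iso); [by exists r|by exists r'|].
  move=> s j j' js ej; rewrite /eta !(imsetK _ fEK).
  rewrite (edge_signE _ _ or ro) (edge_signE _ _ or' ro').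
  rewrite big_imset /=; last by move=> e f _ _; apply: (can_inj fEK).
  have /= := @reorder_sign_setU1 _ (fun e => r e) (fun e => r' (fE e)) s (o j).
  rewrite or -ej or'; apply=> //.
    by move=> e f /val_inj/(can_inj ro).
  by move=> e f /val_inj/(can_inj ro')/(can_inj fEK).
(* The signs are their own inverses, so [eps] serves for the inverse chain map. *)
have h1 (s : {set edge G}) : eta (fE @: s) * eps s = 1.
    by rewrite /eta imsetK // reorder_sign_sqr.
have h2 (s' : {set edge G'}) : eps (gE @: s') * eta s' = 1 by rewrite reorder_sign_sqr.
have K1 j (v : Ci G j) := relabel_chainK iso v h1.
have K2 j (v : Ci G' j) := relabel_chainK (graph_iso_pair_sym iso) v h2.
split.
  exists (fun v : Ci G' i => relabel_chain gV gE eps v : Ci G i) => v.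
    exact: K1.
  exact: K2.
move=> p u; apply/idP/idP => [h|]; last exact: (relabel_chain_comp iso).
rewrite -[u]K1; exact: (relabel_chain_comp (graph_iso_pair_sym iso)).
Qed.

Lemma graph_iso_refl G : graph_iso G G.
Proof.
by exists id, id; split; [exists id|exists id|move=> e; rewrite imset_id].
Qed.

Theorem theorem3p1 (G : mgraph) (o : 'I_#|edge G| -> edge G)
    (ho : bijective o) :
  let n := #|edge G| in
  let C := tutte_complex o in
  (* (a) *)
  [/\ forall i, bigraded (C i),
      forall i, (n < i)%N -> forall u : C i, u = 0,
      forall i (u : C i), cdiff C i.+1 (cdiff C i u) = 0
    & forall i p (u : C i), u \in bgcomp (C i) p ->
        cdiff C i u \in bgcomp (C i.+1) p] /\
  (* (b) *)
  [/\ forall o' : 'I_n -> edge G, bijective o' -> forall i,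
        bgisomorphic (cohomology C i) (cohomology (tutte_complex o') i),
      forall o' : 'I_n -> edge G, bijective o' ->
        cochain_isomorphic C (tutte_complex o')
    & forall (G' : mgraph) (o' : 'I_#|edge G'| -> edge G'),
        graph_iso G G' -> bijective o' ->
        cochain_isomorphic C (tutte_complex o') /\
        forall i,
          bgisomorphic (cohomology C i) (cohomology (tutte_complex o') i)] /\
  (* (c) *)
  [/\ forall i, bigraded (cohomology C i),
      \sum_(i < n.+1) (-1) ^+ i * qdim (cohomology C i) =
      \sum_(i < n.+1) (-1) ^+ i * qdim (C i)
    & \sum_(i < n.+1) (-1) ^+ i * qdim (C i) = That G qx qy].
Proof.
move=> n C; have gC := tutte_graded ho; have [gb dd dh] := gC.
have C0 i : (n < i)%N -> forall u : C i, u = 0.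
  move=> ni u; apply/ffunP=> s; have := max_card (mem (val s)).
  by rewrite (eqP (valP s)) leqNgt ni.
have isoC (o' : 'I_n -> edge G) : bijective o' -> cochain_isomorphic C (tutte_complex o').
  exact: (graph_iso_cochain (graph_iso_refl G) ho).
split; [|split]; split=> //.
- by move=> i; apply: graded_bigraded (gb i).
- by move=> o' /isoC; apply: cochain_iso_cohomology.
- move=> G' o' GG' ho'; have CC := graph_iso_cochain GG' ho ho'.
  by split=> //; apply: cochain_iso_cohomology.
- by move=> i; have [prH] := cohomology_graded gC i; apply: graded_bigraded.
- apply: (euler_characteristic gC); last exact: C0.
  by move=> i p; have [tau ct] := @Ci_comp_chart G i p; exists _, tau.
- exact: (tutte_polynomial ho).
Qed.
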